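(* Let $R$ be a Gorenstein local ring that has the Krull-Remak-Schmidt property. Then $R$ has a non-zero (finitely generated) periodic module if and only if the $\mathbb{Z}[t^{\pm1}]$-module $J(R)$ has a non-zero torsion element.
   Context: All rings are commutative and Noetherian. $\mathcal{C}(R)$ is the set of isomorphism classes of finitely generated $R$-modules and $[M]$ is the class of $M$. Definition of $J(R)$: let $F=\bigoplus_{[M]\in\mathcal{C}(R)}\mathbb{Z}[t^{\pm1}][M]$ be the free $\mathbb{Z}[t^{\pm1}]$-module on $\mathcal{C}(R)$, where $\mathbb{Z}[t^{\pm1}]$ is the ring of Laurent polynomials, and let $I$ be the submodule generated by: (R1) $[M]-[M']$ for every exact sequence $0\to P\to M\to M'\to0$ of finitely generated $R$-modules with $P$ projective; (R2) $[M]-t[M']$ for every exact sequence $0\to M'\to P\to M\to0$ of finitely generated $R$-modules with $P$ projective; (R3) $[M\oplus M']-[M]-[M']$ for all finitely generated $M,M'$. Then $J(R)=F/I$. An element $u$ of a $\mathbb{Z}[t^{\pm1}]$-module is torsion if $ru=0$ for some non-zero $r\in\mathbb{Z}[t^{\pm1}]$. Over a local ring $R$, $\Omega M$ is the kernel of a surjection $R^m\to M$ with $m$ the minimal number of generators of $M$ (unique up to isomorphism), $\Omega^0M=M$ and $\Omega^iM=\Omega(\Omega^{i-1}M)$ for $i\geq1$. The finitely generated module $M$ is periodic if there exists an integer $n\geq1$ with $M\cong\Omega^nM$. A local ring $R$ has the Krull-Remak-Schmidt property if, whenever $\bigoplus_{i=1}^mM_i\cong\bigoplus_{j=1}^nN_j$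 with all $M_i,N_j$ finitely generated, indecomposable and non-zero, one has $m=n$ and, after renumbering, $M_i\cong N_i$ for each $i$. *)

(* Defs.v *)
From HB Require Import structures.
From mathcomp Require Import all_boot all_order all_algebra.
From mathcomp Require Import fraction ring_quotient generic_quotient.
From mathcomp Require Import boolp classical_sets.
From mathcomp Require Import finmap monalg.

Set Implicit Arguments.
Unset Strict Implicit.
Unset Printing Implicit Defensive.

Import GRing.Theory.
Local Open Scope ring_scope.
Local Open Scope classical_set_scope.
Local Open Scope quotient_scope.

(** * Modules *)

Definition submodule (A : comNzRingType) (V : lmodType A) (S : set V) : Prop :=
  S 0 /\ forall (a : A) (u v : V), S u -> S v -> S (a *: u + v).

Definition zero_module (A : comNzRingType) (M : lmodType A) : Prop :=
  forall x : M, x = 0.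

Definition surjective_fun (T U : Type) (f : T -> U) : Prop :=
  forall y, exists x, f x = y.

Definition isomorphic (A : comNzRingType) (M N : lmodType A) : Prop :=
  exists f : {linear M -> N}, bijective f.

Definition short_exact (A : comNzRingType) (L M N : lmodType A)
    (i : {linear L -> M}) (p : {linear M -> N}) : Prop :=
  [/\ injective i, range i = p @^-1` [set 0] & surjective_fun p].

Definition generated_by (A : comNzRingType) (M : lmodType A) (n : nat) : Prop :=
  exists v : 'I_n -> M,
    forall x, exists c : 'I_n -> A, x = \sum_(i < n) c i *: v i.

Definition finitely_generated (A : comNzRingType) (M : lmodType A) : Prop :=
  exists n, generated_by M n.

Definition min_generators (A : comNzRingType) (M : lmodType A) (n : nat) : Prop :=
  generated_by M n /\ forall k, generated_by M k -> (n <= k)%N.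

Definition projective (A : comNzRingType) (P : lmodType A) : Prop :=
  forall (M N : lmodType A) (f : {linear M -> N}) (g : {linear P -> N}),
    surjective_fun f -> exists h : {linear P -> M}, forall x, f (h x) = g x.

Definition injective_module (A : comNzRingType) (E : lmodType A) : Prop :=
  forall (M N : lmodType A) (f : {linear M -> N}) (g : {linear M -> E}),
    injective f -> exists h : {linear N -> E}, forall x, h (f x) = g x.

Definition indecomposable (A : comNzRingType) (M : lmodType A) : Prop :=
  forall N L : lmodType A,
    isomorphic M (N * L)%type -> zero_module N \/ zero_module L.

(* The external direct sum of a finite family of modules, realised as the
   product of the family with pointwise operations. *)
Section DirectSum.
Variables (A : comNzRingType) (n : nat) (M : 'I_n -> lmodType A).

Definition dsum : Type := forall i, M i.

HB.instance Definition _ := Choice.on dsum.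

Let add (f g : dsum) : dsum := fun i => f i + g i.
Let opp (f : dsum) : dsum := fun i => - f i.
Let zero : dsum := fun i => 0.
Let scale (a : A) (f : dsum) : dsum := fun i => a *: f i.

Let addA : associative add.
Proof.
by move=> f g h; apply: functional_extensionality_dep => i; rewrite /add addrA.
Qed.

Let addC : commutative add.
Proof.
by move=> f g; apply: functional_extensionality_dep => i; rewrite /add addrC.
Qed.

Let add0 : left_id zero add.
Proof.
by move=> f; apply: functional_extensionality_dep => i; rewrite /add add0r.
Qed.

Let addN : left_inverse zero opp add.
Proof.
by move=> f; apply: functional_extensionality_dep => i; rewrite /add addNr.
Qed.

HB.instance Definition _ := GRing.isZmodule.Build dsum addA addC add0 addN.

Let scaleA a b f : scale a (scale b f) = scale (a * b) f.
Proof.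
by apply: functional_extensionality_dep => i; rewrite /scale scalerA.
Qed.

Let scale1 : left_id 1 scale.
Proof.
by move=> f; apply: functional_extensionality_dep => i; rewrite /scale scale1r.
Qed.

Let scaleDr : right_distributive scale +%R.
Proof.
move=> a f g; apply: functional_extensionality_dep => i.
exact: (scalerDr a (f i) (g i)).
Qed.

Let scaleDl f : {morph scale^~ f : a b / a + b}.
Proof.
move=> a b; apply: functional_extensionality_dep => i.
exact: (scalerDl (f i) a b).
Qed.

HB.instance Definition _ :=
  GRing.Zmodule_isLmodule.Build A dsum scaleA scale1 scaleDr scaleDl.

End DirectSum.

(** * Rings *)

Definition ideal (R : comNzRingType) (I : set R) : Prop :=
  @submodule R R^o I.

Definition noetherian (R : comNzRingType) : Prop :=
  forall I : set R, ideal I ->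
    exists (n : nat) (v : 'I_n -> R),
      I = [set x | exists c : 'I_n -> R, x = \sum_(i < n) c i * v i].

Definition maximal_ideal (R : comNzRingType) (m : set R) : Prop :=
  [/\ ideal m, m <> setT &
      forall I : set R, ideal I -> m `<=` I -> I = m \/ I = setT].

Definition local_ring (R : comNzRingType) : Prop :=
  exists m : set R, maximal_ideal m /\
    forall m' : set R, maximal_ideal m' -> m' = m.

(* There is an exact sequence 0 -> M -> E 0 -> E 1 -> ... -> E n -> 0
   with every E k injective. *)
Definition finite_injective_dimension (A : comNzRingType) (M : lmodType A) :
    Prop :=
  exists (n : nat) (E : nat -> lmodType A) (e : {linear M -> E 0%N})
      (d : forall k, {linear E k -> E k.+1}),
    [/\ forall k, injective_module (E k),
        forall k, (n < k)%N -> zero_module (E k),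
        injective e,
        range e = d 0%N @^-1` [set 0] &
        forall k, range (d k) = d k.+1 @^-1` [set 0]].

Definition gorenstein_local (R : comNzRingType) : Prop :=
  [/\ noetherian R, local_ring R & finite_injective_dimension (R^o : lmodType R)].

Definition krull_remak_schmidt (R : comNzRingType) : Prop :=
  forall (m n : nat) (M : 'I_m -> lmodType R) (N : 'I_n -> lmodType R),
    (forall i, [/\ finitely_generated (M i), indecomposable (M i) &
                   ~ zero_module (M i)]) ->
    (forall j, [/\ finitely_generated (N j), indecomposable (N j) &
                   ~ zero_module (N j)]) ->
    isomorphic (dsum M) (dsum N) ->
    m = n /\ exists s : 'I_m -> 'I_n,
      bijective s /\ forall i, isomorphic (M i) (N (s i)).

(** * Syzygies and periodic modules *)

(* [syzygy M N] means that N is (a copy of) Omega M; since Omega M is only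
   determined up to isomorphism, it is handled as a relation. *)
Definition syzygy (R : comNzRingType) (M N : lmodType R) : Prop :=
  exists m : nat, min_generators M m /\
    exists (i : {linear N -> 'rV[R]_m}) (p : {linear 'rV[R]_m -> M}),
      short_exact i p.

Fixpoint nth_syzygy (R : comNzRingType) (n : nat) (M N : lmodType R) : Prop :=
  match n with
  | 0%N => isomorphic M N
  | n'.+1 => exists L : lmodType R, nth_syzygy n' M L /\ syzygy L N
  end.

Definition periodic (R : comNzRingType) (M : lmodType R) : Prop :=
  exists n : nat, (1 <= n)%N /\
    exists N : lmodType R, nth_syzygy n M N /\ isomorphic M N.

(** * Isomorphism classes of finitely generated modules *)

Record fgmod (R : comNzRingType) := FGMod {
  fgmod_sort :> lmodType R;
  fgmodP : finitely_generated fgmod_sort }.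

Lemma fg_prod (R : comNzRingType) (M N : fgmod R) :
  finitely_generated ((M : lmodType R) * (N : lmodType R))%type.
Proof.
case: M N => [M [m [u hu]]] [N [n [v hv]]] /=.
exists (m + n)%N.
exists (fun i => match split i with inl j => (u j, 0) | inr k => (0, v k) end).
move=> [x y]; have [a ->] := hu x; have [b ->] := hv y.
exists (fun i => match split i with inl j => a j | inr k => b k end).
have Efst (I : finType) (F : I -> (M * N)%type) :
    (\sum_i F i).1 = \sum_i (F i).1 by exact: (raddf_sum fst).
have Esnd (I : finType) (F : I -> (M * N)%type) :
    (\sum_i F i).2 = \sum_i (F i).2 by exact: (raddf_sum snd).
have spl i : split (lshift n i) = inl i := unsplitK (inl i).
have spr j : split (rshift m j) = inr j := unsplitK (inr j).
rewrite [RHS]surjective_pairing Efst Esnd !big_split_ord /=; congr pair.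
  rewrite [X in _ = _ + X]big1 => [|i _]; last by rewrite spr scaler0.
  by rewrite addr0; apply: eq_bigr => i _; rewrite spl.
rewrite [X in _ = X + _]big1 => [|i _]; last by rewrite spl scaler0.
by rewrite add0r; apply: eq_bigr => i _; rewrite spr.
Qed.

Definition fgmod_dsum (R : comNzRingType) (M N : fgmod R) : fgmod R :=
  FGMod (fg_prod M N).

(* A pair (n, K) with K a subset of R^n. When K is a submodule it presents the
   module R^n / K, and every finitely generated module is isomorphic to one of
   these. *)
Definition presentation (R : comNzRingType) : Type :=
  {n : nat & set 'rV[R]_n}.

Definition presentations (R : comNzRingType) (M : lmodType R) :
    set (presentation R) :=
  [set s | exists f : {linear 'rV[R]_(projT1 s) -> M},
     surjective_fun f /\ f @^-1` [set 0] = projT2 s].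

(* The isomorphism class of M is represented by the set of all presentations
   of M rather than by the collection of all modules isomorphic to M; this
   keeps the type of isomorphism classes in the universe of R, so that free
   modules can be built on it. By [mclassP] below two finitely generated
   modules have the same class if and only if they are isomorphic. *)
Definition mclasses (R : comNzRingType) : Type :=
  {C : set (presentation R) | exists M : fgmod R, C = presentations M}.

HB.instance Definition _ (R : comNzRingType) := gen_eqMixin (mclasses R).
HB.instance Definition _ (R : comNzRingType) := gen_choiceMixin (mclasses R).

Definition mclass (R : comNzRingType) (M : fgmod R) : mclasses R :=
  exist _ (presentations M) (ex_intro _ M erefl).

Lemma mclass_surj (R : comNzRingType) (c : mclasses R) :
  exists M : fgmod R, c = mclass M.
Proof. by case: c => C [M eC]; exists M; apply: eq_exist. Qed.

Lemma mclassP (R : comNzRingType) (M N : fgmod R) :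
  mclass M = mclass N <-> isomorphic M N.
Proof.
split=> [/(congr1 sval) /= eMN | [f [g fK gK]]]; last first.
  apply: eq_exist; apply/seteqP; split=> -[n K] /= [h [hs hK]].
    exists (f \o h : {linear _ -> _}); split.
      by move=> y; have [x hx] := hs (g y); exists x; rewrite /= hx gK.
    rewrite -hK; apply/seteqP; split=> x /=.
      by move=> e; apply: (can_inj fK); rewrite raddf0.
    by move=> ->; rewrite raddf0.
  have glin : linear g.
    by move=> a u v; apply: (can_inj fK); rewrite linearP !gK.
  pose g' : {linear _ -> _} :=
    HB.pack g (GRing.isLinear.Build R N M *:%R g glin).
  exists (g' \o h : {linear _ -> _}); split.
    by move=> y; have [x hx] := hs (f y); exists x; rewrite /= hx fK.
  rewrite -hK; apply/seteqP; split=> x /=.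
    by move=> e; apply: (can_inj gK); rewrite e; exact/esym/(raddf0 g').
  by move=> ->; exact: (raddf0 g').
have [n [v hv]] := fgmodP M.
have lin : linear (fun c : 'rV[R]_n => \sum_(i < n) c 0 i *: v i).
  move=> a b c; rewrite scaler_sumr -big_split /=.
  by apply: eq_bigr => i _; rewrite !mxE scalerDl scalerA.
pose h : {linear 'rV[R]_n -> M} :=
  HB.pack (fun c : 'rV[R]_n => \sum_(i < n) c 0 i *: v i)
    (GRing.isLinear.Build R 'rV[R]_n M *:%R _ lin).
have hs : surjective_fun h.
  move=> x; have [c ->] := hv x; exists (\row_i c i).
  by apply: eq_bigr => i _; rewrite mxE.
have hM : presentations M (existT _ n (h @^-1` [set 0])) by exists h.
rewrite eMN in hM; case: hM => k [ks /= kK].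
have hk x y : (h x = h y) <-> (k x = k y).
  have kK' z : k z = 0 <-> h z = 0 by move: (congr1 (@^~ z) kK) => /= ->.
  have hB : h (x - y) = h x - h y := raddfB h x y.
  have kB : k (x - y) = k x - k y := raddfB k x y.
  split=> e; apply/eqP; rewrite -subr_eq0.
    by rewrite -kB; apply/eqP/kK'; rewrite hB e subrr.
  by rewrite -hB; apply/eqP/kK'; rewrite kB e subrr.
pose s y := sval (cid (hs y)); have sP y : h (s y) = y := svalP (cid (hs y)).
pose t y := sval (cid (ks y)); have tP y : k (t y) = y := svalP (cid (ks y)).
have flin : linear (k \o s).
  by move=> a u w /=; rewrite -linearP; apply/hk; rewrite linearP !sP.
exists (HB.pack (k \o s) (GRing.isLinear.Build R M N *:%R _ flin)
  : {linear M -> N}).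
exists (h \o t) => y /=; first by rewrite -[RHS]sP; apply/hk; rewrite tP.
by rewrite -[RHS]tP; apply/hk; rewrite sP.
Qed.

(** * Laurent polynomials *)

(* Z[t, t^-1] is the localisation of Z[t] at t, i.e. the subring of the
   fraction field of Z[t] consisting of the fractions p / t^n. *)
Definition laurent_pred : pred {fraction {poly int}} :=
  fun f => `[< exists (p : {poly int}) (n : nat),
                 f = tofrac p / tofrac 'X^n >].

Lemma laurent_subring : subring_closed laurent_pred.
Proof.
have Xn0 n : tofrac ('X^n : {poly int}) != 0.
  by rewrite tofrac_eq0 monic_neq0 // monicXn.
split=> [|_ _ /asboolP[p [m ->]] /asboolP[q [n ->]]
         |_ _ /asboolP[p [m ->]] /asboolP[q [n ->]]]; apply/asboolP.
- by exists 1, 0%N; rewrite expr0 tofrac1 divr1.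
- exists (p * 'X^n - q * 'X^m), (m + n)%N.
  by rewrite -mulNr addf_div // exprD !rmorphB !rmorphM /= mulNr.
- by exists (p * q), (m + n)%N; rewrite mulf_div exprD !rmorphM.
Qed.

HB.instance Definition _ :=
  GRing.isSubringClosed.Build {fraction {poly int}} laurent_pred
    laurent_subring.

Record laurent := Laurent {
  laurent_val :> {fraction {poly int}};
  laurentP : laurent_val \in laurent_pred }.

HB.instance Definition _ := [isSub for laurent_val].
HB.instance Definition _ := [Choice of laurent by <:].
HB.instance Definition _ := [SubChoice_isSubComNzRing of laurent by <:].

Lemma laurent_t_subproof : tofrac ('X : {poly int}) \in laurent_pred.
Proof. by apply/asboolP; exists 'X, 0%N; rewrite expr0 tofrac1 divr1. Qed.

Definition laurent_t : laurent := Laurent laurent_t_subproof.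

(** * Spans, quotient modules and torsion *)

Definition span_pred (A : comNzRingType) (V : lmodType A) (G : set V) : pred V :=
  fun x => `[< forall S : set V, submodule S -> G `<=` S -> S x >].

Lemma span_submod (A : comNzRingType) (V : lmodType A) (G : set V) :
  submod_closed (span_pred G).
Proof.
split; first by apply/asboolP => S [].
move=> a u v /asboolP hu /asboolP hv; apply/asboolP => S sS GS.
by apply: (proj2 sS); [apply: hu | apply: hv].
Qed.

HB.instance Definition _ (A : comNzRingType) (V : lmodType A) (G : set V) :=
  GRing.isSubmodClosed.Build A V (span_pred G) (span_submod G).

Section QuotientModule.
Variables (A : comNzRingType) (V : lmodType A) (G : set V).

Local Notation Q :=
  (Quotient.quot (GRing.ZmodClosed.clone V (span_pred G) _)).

(* The quotient of V by the submodule generated by G. *)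
Definition quotmod : Type := Q.

HB.instance Definition _ := GRing.Zmodule.on quotmod.

Let scale (a : A) (x : quotmod) : quotmod :=
  \pi_Q (a *: repr x).

Let scale_pi a v : scale a (\pi_Q v) = \pi_Q (a *: v).
Proof.
apply/eqP; rewrite -Quotient.idealrBE -scalerBr rpredZ //.
by rewrite Quotient.idealrBE reprK.
Qed.

Let piD u v : \pi_Q (u + v) = \pi_Q u + \pi_Q v.
Proof. by rewrite raddfD. Qed.

Let piP (x : quotmod) : exists v, x = \pi_Q v.
Proof. by exists (repr (x : Q)); rewrite reprK. Qed.

Let scaleA a b x : scale a (scale b x) = scale (a * b) x.
Proof. by have [v ->] := piP x; rewrite !scale_pi scalerA. Qed.

Let scale1 : left_id 1 scale.
Proof. by move=> x; have [v ->] := piP x; rewrite scale_pi scale1r. Qed.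

Let scaleDr : right_distributive scale +%R.
Proof.
move=> a x y; have [u ->] := piP x; have [v ->] := piP y.
by rewrite -[_ + _](piD u v) !scale_pi scalerDr piD.
Qed.

Let scaleDl x : {morph scale^~ x : a b / a + b}.
Proof.
by move=> a b; have [v ->] := piP x; rewrite !scale_pi scalerDl piD.
Qed.

HB.instance Definition _ :=
  GRing.Zmodule_isLmodule.Build A quotmod scaleA scale1 scaleDr scaleDl.

Definition quot_proj (v : V) : quotmod := \pi_Q v.

Lemma quot_proj_linear : linear quot_proj.
Proof. by move=> a u v; rewrite /quot_proj piD -scale_pi. Qed.

HB.instance Definition _ :=
  GRing.isLinear.Build A V quotmod *:%R quot_proj quot_proj_linear.

Lemma quot_proj_surj : surjective_fun quot_proj.
Proof. by move=> x; have [v ->] := piP x; exists v. Qed.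

Lemma quot_proj_eq0 v : (quot_proj v == 0) = (v \in span_pred G).
Proof.
have <- : quot_proj 0 = 0 by rewrite raddf0.
by rewrite /quot_proj -[LHS]Quotient.idealrBE subr0.
Qed.

End QuotientModule.

Definition torsion (A : comNzRingType) (V : lmodType A) (u : V) : Prop :=
  exists r : A, r != 0 /\ r *: u = 0.

(** * The module J(R) *)

Definition Jfree (R : comNzRingType) : lmodType laurent :=
  {malg laurent[mclasses R]}.

Definition Jbasis (R : comNzRingType) (M : fgmod R) : Jfree R :=
  << mclass M >>.

Inductive Jrel (R : comNzRingType) : set (Jfree R) :=
| Jrel1 (P M M' : fgmod R) (i : {linear P -> M}) (p : {linear M -> M'}) of
    projective P & short_exact i p :
    Jrel (Jbasis M - Jbasis M')
| Jrel2 (M' P M : fgmod R) (i : {linear M' -> P}) (p : {linear P -> M}) of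
    projective P & short_exact i p :
    Jrel (Jbasis M - laurent_t *: Jbasis M')
| Jrel3 (M M' : fgmod R) :
    Jrel (Jbasis (fgmod_dsum M M') - Jbasis M - Jbasis M').

Definition J (R : comNzRingType) : lmodType laurent :=
  quotmod (@Jrel R).

(* Main.v *)
From HB Require Import structures.
From mathcomp Require Import all_boot all_order all_algebra.
From mathcomp Require Import boolp classical_sets.
From mathcomp Require Import finmap monalg fraction.
From mathcomp Require Import ring zify.
Require Import Defs.

(** Isomorphism classes of finitely generated modules form a commutative monoid
    under direct sum, and by the Krull-Remak-Schmidt property this monoid is
    free on the classes of non-zero indecomposable modules, called atoms here:
    a class is determined by its multiplicities [mult s]. The class [rho] of R
    is an atom, and two classes with the same multiplicities at all atoms
    other than [rho] are stably equal. Write [om] for the minimal syzygy on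
    classes. By Schanuel's lemma it is additive and compatible with stable
    equality, up to stable equality ([omD], [om_stable]), and in J the class of
    c is t times the class of [om c].

    Hence t acts on J as an inverse of [om], and J is the direct limit of the
    stable classes along [om]. Half of this is what the proof needs:
    if a combination of classes vanishes in J, then its multiplicities at the
    atoms other than [rho], computed on N-th syzygies, vanish for all large N
    ([quot_proj_eventually0]).

    If [iter n om c = c] with 0 < n and c non-zero, then 1 - t^n kills the
    class of c in J. This class is not zero: otherwise high syzygies of c, and
    so c itself, would be free, whence c = 0 because [om] kills free modules.

    Conversely, over a Gorenstein local ring sufficiently high syzygies M
    satisfy Ext^i(M, R) = 0 for all i > 0, by dimension shifting along a finite
    injective resolution of R ([gorenstein_mcm]). The minimal syzygy of such an
    indecomposable non-free M is indecomposable and non-free, or zero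
    ([om_mcm_atom]): it has no free summand, because a projection onto R would
    extend to the free cover of M, where the syzygy has no invertible
    coordinate, and so take non-invertible values only; and it is
    indecomposable, because the dual of Schanuel's lemma turns a decomposition
    of the syzygy into a stable decomposition of M. Therefore [om] maps the set
    of atoms of this kind to itself and zero. A torsion element of J is, up to
    a power of t, a difference [X] - [Y] of classes whose non-free summands are
    of this kind, killed by a non-zero polynomial in t. If no atom were
    periodic, the relation that s precedes s' when s' is a higher syzygy of s
    would be a strict order; at a minimal s whose multiplicities in X and Y
    differ, the leading coefficient of the polynomial is the only one that
    contributes to the multiplicity, a contradiction ([minimal_summand],
    [J_torsion_periodic]). *)

Set Implicit Arguments.
Unset Strict Implicit.
Unset Printing Implicit Defensive.

Import GRing.Theory.
Local Open Scope ring_scope.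
Local Open Scope classical_set_scope.

(** * Linear maps and short exact sequences *)

Section LinearMaps.
Variable R : comNzRingType.
Implicit Types L M N P X : lmodType R.

(** A function with a proof of linearity, bundled as a linear map. *)
Definition mklin M N (f : M -> N) (lf : linear f) : {linear M -> N} :=
  HB.pack f (GRing.isLinear.Build R M N *:%R f lf).

Lemma cancel_isomorphic M N (f : {linear M -> N}) (g : N -> M) :
  cancel f g -> cancel g f -> isomorphic M N.
Proof. by move=> fK gK; exists f, g. Qed.

Lemma isomorphic_refl M : isomorphic M M.
Proof. by exists (idfun : {linear M -> M}), id. Qed.

Lemma isomorphic_sym M N : isomorphic M N -> isomorphic N M.
Proof.
case=> f [g fK gK].
have glin : linear g.
  by move=> a u v; apply: (can_inj fK); rewrite linearP !gK.
by exists (mklin glin), f.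
Qed.

Lemma isomorphic_trans M N P :
  isomorphic M N -> isomorphic N P -> isomorphic M P.
Proof.
by move=> [f bf] [g bg]; exists (g \o f : {linear M -> P}); apply: bij_comp.
Qed.

Lemma pair_lin_subproof L M N (f : {linear L -> M}) (g : {linear L -> N}) :
  linear (fun x => (f x, g x) : (M * N)%type).
Proof. by move=> a u v; rewrite !linearP. Qed.

(** The linear map into a product with the given components. *)
Definition pair_lin L M N (f : {linear L -> M}) (g : {linear L -> N}) :
  {linear L -> (M * N)%type} := mklin (pair_lin_subproof f g).

Lemma copair_lin_subproof L M N (f : {linear M -> L}) (g : {linear N -> L}) :
  linear (fun x : (M * N)%type => f x.1 + g x.2).
Proof.
move=> a u v /=; rewrite !linearP /= scalerDr -!addrA; congr (_ + _).
by rewrite addrCA.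
Qed.

(** The linear map out of a product with the given restrictions. *)
Definition copair_lin L M N (f : {linear M -> L}) (g : {linear N -> L}) :
  {linear (M * N)%type -> L} := mklin (copair_lin_subproof f g).

(** The product of two linear maps. *)
Definition prod_lin M N M' N' (f : {linear M -> M'}) (g : {linear N -> N'}) :
  {linear (M * N)%type -> (M' * N')%type} :=
  pair_lin (f \o fst : {linear _ -> _}) (g \o snd : {linear _ -> _}).

Lemma inl_lin_subproof M N : linear (fun x : M => (x, 0) : (M * N)%type).
Proof. by move=> a u v; congr pair; rewrite /= scaler0 addr0. Qed.

Definition inl_lin M N : {linear M -> (M * N)%type} :=
  mklin (@inl_lin_subproof M N).

Lemma inr_lin_subproof M N : linear (fun x : N => (0, x) : (M * N)%type).
Proof. by move=> a u v; congr pair; rewrite /= scaler0 addr0. Qed.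

Definition inr_lin M N : {linear N -> (M * N)%type} :=
  mklin (@inr_lin_subproof M N).

Lemma isomorphic_prod M N M' N' :
  isomorphic M M' -> isomorphic N N' ->
  isomorphic (M * N)%type (M' * N')%type.
Proof.
move=> [f [f' fK f'K]] [g [g' gK g'K]].
apply: (@cancel_isomorphic _ _ (prod_lin f g) (fun x => (f' x.1, g' x.2))).
  by case=> x y /=; rewrite fK gK.
by case=> x y /=; rewrite f'K g'K.
Qed.

Lemma isomorphic_prodC M N : isomorphic (M * N)%type (N * M)%type.
Proof.
apply: (@cancel_isomorphic _ _
  (pair_lin (snd : {linear _ -> _}) (fst : {linear _ -> _}))
  (fun x => (x.2, x.1))); by case.
Qed.

Lemma isomorphic_prodA M N P :
  isomorphic (M * (N * P))%type ((M * N) * P)%type.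
Proof.
apply: (@cancel_isomorphic _ _
  (pair_lin
     (pair_lin (fst : {linear _ -> _}) (fst \o snd : {linear _ -> _}))
     (snd \o snd : {linear _ -> _}))
  (fun x => (x.1.1, (x.1.2, x.2)))); by [case=> x [] | case=> [[]]].
Qed.

Lemma isomorphic_prod0 M N : zero_module M -> isomorphic (M * N)%type N.
Proof.
move=> M0; apply: (@cancel_isomorphic _ _ (snd : {linear _ -> _})
  (fun x => (0, x))) => //.
by case=> x y /=; rewrite [x]M0.
Qed.

Lemma zero_isomorphic M N : isomorphic M N -> zero_module M -> zero_module N.
Proof. by move=> [f [g fK gK]] M0 x; rewrite -[x]gK [g x]M0 raddf0. Qed.

Lemma zero_modules_isomorphic M N :
  zero_module M -> zero_module N -> isomorphic M N.
Proof.
by move=> M0 N0; exists (\0 : {linear M -> N}), (fun=> 0) => x;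
  rewrite ?[x]M0 ?[x]N0 ?[LHS]M0 ?[LHS]N0.
Qed.

Lemma isomorphic_fg M N :
  isomorphic M N -> finitely_generated M -> finitely_generated N.
Proof.
move=> [f [g fK gK]] [n [v hv]]; exists n, (f \o v) => x.
have [c e] := hv (g x); exists c; rewrite -[x]gK e linear_sum.
by apply: eq_bigr => i _; rewrite linearZ.
Qed.

Lemma surjective_fg M N (f : {linear M -> N}) :
  surjective_fun f -> finitely_generated M -> finitely_generated N.
Proof.
move=> fs [n [v hv]]; exists n, (f \o v) => y.
have [x <-] := fs y; have [c ->] := hv x; exists c; rewrite linear_sum.
by apply: eq_bigr => i _; rewrite linearZ.
Qed.

Section ShortExact.
Variables (L M N : lmodType R) (i : {linear L -> M}) (p : {linear M -> N}).
Hypothesis ex : short_exact i p.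

Lemma ses_inj : injective i. Proof. by case: ex. Qed.
Lemma ses_surj : surjective_fun p. Proof. by case: ex. Qed.

Lemma ses_comp x : p (i x) = 0.
Proof.
case: ex => _ e _; suff : (p @^-1` [set 0]) (i x) by [].
by rewrite -e; exists x.
Qed.

Lemma ses_ker y : p y = 0 -> exists x, i x = y.
Proof.
case: ex => _ e _ py; have : (p @^-1` [set 0]) y by [].
by rewrite -e => -[x _ <-]; exists x.
Qed.

(** The universal property of the kernel. *)
Lemma ses_lift_ker (X : lmodType R) (g : {linear X -> M}) :
  (forall x, p (g x) = 0) -> exists h : {linear X -> L}, forall x, i (h x) = g x.
Proof.
move=> pg; have hP x : exists y, i y = g x by apply: ses_ker.
pose h x := sval (cid (hP x)).
have ih x : i (h x) = g x := svalP (cid (hP x)).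
have hl : linear h by move=> a u v; apply: ses_inj; rewrite linearP !ih linearP.
by exists (mklin hl).
Qed.

(** The universal property of the cokernel. *)
Lemma ses_factor_coker (X : lmodType R) (g : {linear M -> X}) :
  (forall x, g (i x) = 0) -> exists h : {linear N -> X}, forall x, h (p x) = g x.
Proof.
move=> gi; have hP y := ses_surj y.
pose s y := sval (cid (hP y)).
have sK y : p (s y) = y := svalP (cid (hP y)).
have gp x y : p x = p y -> g x = g y.
  move=> e; have [z ez] : exists z, i z = x - y.
    by apply: ses_ker; rewrite linearB /= e subrr.
  by apply/eqP; rewrite -subr_eq0 -linearB /= -ez gi.
have hl : linear (g \o s).
  by move=> a u v /=; rewrite -linearP; apply: gp; rewrite linearP !sK.
by exists (mklin hl) => x /=; apply: gp; rewrite sK.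
Qed.

End ShortExact.

Lemma short_exactI L M N (i : {linear L -> M}) (p : {linear M -> N}) :
  injective i -> (forall x, p (i x) = 0) ->
  (forall y, p y = 0 -> exists x, i x = y) -> surjective_fun p ->
  short_exact i p.
Proof.
move=> ii pi k ps; split=> //; apply/seteqP; split=> [y [x _ <-] | y /= /k [x <-]].
  by rewrite /= pi.
by exists x.
Qed.

Lemma short_exact_prod L M N L' M' N' (i : {linear L -> M})
    (p : {linear M -> N}) (i' : {linear L' -> M'}) (p' : {linear M' -> N'}) :
  short_exact i p -> short_exact i' p' ->
  short_exact (prod_lin i i') (prod_lin p p').
Proof.
move=> ex ex'; apply: short_exactI.
- by case=> a b [c d] /= [/(ses_inj ex) -> /(ses_inj ex') ->].
- by case=> a b /=; rewrite (ses_comp ex) (ses_comp ex').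
- case=> a b /= [/(ses_ker ex) [x <-] /(ses_ker ex') [y <-]].
  by exists (x, y).
- case=> a b /=; have [x <-] := ses_surj ex a.
  by have [y <-] := ses_surj ex' b; exists (x, y).
Qed.

(** Schanuel's lemma. *)
Lemma schanuel M N P N' P' (i : {linear N -> P}) (p : {linear P -> M})
    (i' : {linear N' -> P'}) (p' : {linear P' -> M}) :
  projective P -> projective P' -> short_exact i p -> short_exact i' p' ->
  isomorphic (N * P')%type (N' * P)%type.
Proof.
move=> pP pP' ex ex'.
have [a pa] := pP _ _ p' p (ses_surj ex').
have [b pb] := pP' _ _ p p' (ses_surj ex).
(* Both sides are isomorphic to the pullback of p and p'. *)
pose u : {linear (N * P')%type -> P} := copair_lin i b.
pose v : {linear (N' * P)%type -> P'} := copair_lin i' a.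
have pu x : p (u x) = p' x.2 by rewrite /= linearD /= (ses_comp ex) add0r pb.
have pv x : p' (v x) = p x.2 by rewrite /= linearD /= (ses_comp ex') add0r pa.
have [f fP] := ses_lift_ker ex' (g := (snd \- (a \o u)) : {linear _ -> _})
  (fun x => ltac:(by rewrite /= raddfB /= pa pu subrr)).
have [g gP] := ses_lift_ker ex (g := (snd \- (b \o v)) : {linear _ -> _})
  (fun x => ltac:(by rewrite /= raddfB /= pb pv subrr)).
pose F := pair_lin f u; pose G := pair_lin g v.
have vF x : v (F x) = x.2 by rewrite /v /= fP /= subrK.
have uG x : u (G x) = x.2 by rewrite /u /= gP /= subrK.
apply: (@cancel_isomorphic _ _ F G) => x; rewrite [RHS]surjective_pairing.
- congr pair; last exact: vF.
  by apply: (ses_inj ex); rewrite gP -[LHS]/(u x - b (v (F x))) vF addrK.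
- congr pair; last exact: uG.
  by apply: (ses_inj ex'); rewrite fP -[LHS]/(v x - a (u (G x))) uG addrK.
Qed.

(** The dual of Schanuel's lemma, for two embeddings of [X] that extend along
    each other. *)
Lemma schanuel_dual X M N M' N' (i : {linear X -> M}) (p : {linear M -> N})
    (i' : {linear X -> M'}) (p' : {linear M' -> N'})
    (f : {linear M -> M'}) (g : {linear M' -> M}) :
  short_exact i p -> short_exact i' p' ->
  (forall x, f (i x) = i' x) -> (forall x, g (i' x) = i x) ->
  isomorphic (N * M')%type (N' * M)%type.
Proof.
move=> ex ex' fi gi'.
(* Both sides are isomorphic to the pushout of i and i'. *)
have [c cP] := ses_factor_coker ex (g := (p' \o f) : {linear _ -> _})
  (fun x => ltac:(by rewrite /= fi (ses_comp ex'))).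
have [c' c'P] := ses_factor_coker ex' (g := (p \o g) : {linear _ -> _})
  (fun x => ltac:(by rewrite /= gi' (ses_comp ex))).
have [d dP] := ses_factor_coker ex
  (g := (idfun \- (g \o f)) : {linear _ -> _})
  (fun x => ltac:(by rewrite /= fi gi' subrr)).
have [d' d'P] := ses_factor_coker ex'
  (g := (idfun \- (f \o g)) : {linear _ -> _})
  (fun x => ltac:(by rewrite /= gi' fi subrr)).
pose F : {linear (N * M')%type -> (N' * M)%type} :=
  pair_lin (copair_lin ((\- c) : {linear _ -> _}) p') (copair_lin d g).
pose G : {linear (N' * M)%type -> (N * M')%type} :=
  pair_lin (copair_lin ((\- c') : {linear _ -> _}) p) (copair_lin d' f).
have FE x y : F (p x, y) = (p' (y - f x), x + g (y - f x)).
  by rewrite /= cP dP /= !linearB /= addrC addrA addrAC.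
have GE x y : G (p' y, x) = (p (x - g y), y + f (x - g y)).
  by rewrite /= c'P d'P /= !linearB /= addrC addrA addrAC.
apply: (@cancel_isomorphic _ _ F G).
- case=> n y; have [x <-] := ses_surj ex n.
  by rewrite FE GE addrK subrK.
- case=> n x; have [y <-] := ses_surj ex' n.
  by rewrite GE FE addrK subrK.
Qed.

End LinearMaps.

(** * Finite free modules *)

Section FreeModules.
Variable R : comNzRingType.
Implicit Types L M N P X : lmodType R.

Lemma lincomb_subproof M n (v : 'I_n -> M) :
  linear (fun c : 'rV[R]_n => \sum_(i < n) c 0 i *: v i).
Proof.
move=> a b c; rewrite scaler_sumr -big_split /=.
by apply: eq_bigr => i _; rewrite !mxE scalerDl scalerA.
Qed.

(** The linear map from a free module with prescribed values on the basis. *)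
Definition lincomb M n (v : 'I_n -> M) : {linear 'rV[R]_n -> M} :=
  mklin (lincomb_subproof v).

Lemma lincombE M n (v : 'I_n -> M) (c : 'I_n -> R) :
  lincomb v (\row_i c i) = \sum_(i < n) c i *: v i.
Proof. by apply: eq_bigr => i _; rewrite mxE. Qed.

Lemma lincomb_surj M n (v : 'I_n -> M) :
  (forall x, exists c : 'I_n -> R, x = \sum_(i < n) c i *: v i) ->
  surjective_fun (lincomb v).
Proof. by move=> h x; have [c ->] := h x; exists (\row_i c i); rewrite lincombE. Qed.

Lemma linear_rV M n (f : {linear 'rV[R]_n -> M}) x :
  f x = \sum_(i < n) x 0 i *: f (delta_mx 0 i).
Proof.
rewrite {1}(row_sum_delta x) linear_sum; apply: eq_bigr => i _.
by rewrite linearZ.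
Qed.

(** It suffices to lift the values on the basis; [f] need not be surjective. *)
Lemma rV_lift M N n (f : {linear M -> N}) (g : {linear 'rV[R]_n -> N}) :
  (forall i, exists y, f y = g (delta_mx 0 i)) ->
  exists h : {linear 'rV[R]_n -> M}, forall x, f (h x) = g x.
Proof.
move=> hf; pose v i := sval (cid (hf i)).
have fv i : f (v i) = g (delta_mx 0 i) := svalP (cid (hf i)).
exists (lincomb v) => x; rewrite /= linear_sum linear_rV.
by apply: eq_bigr => i _; rewrite linearZ fv.
Qed.

Lemma projective_rV n : projective 'rV[R]_n.
Proof. by move=> M N f g fs; apply: rV_lift => i; apply: fs. Qed.

Lemma fg_rV n : finitely_generated 'rV[R]_n.
Proof.
exists n, (fun i => delta_mx 0 i) => x; exists (fun i => x 0 i).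
exact: row_sum_delta.
Qed.

Lemma projective_prod P P' :
  projective P -> projective P' -> projective (P * P')%type.
Proof.
move=> hP hP' M N f g fs.
have [h hE] := hP _ _ f (g \o @inl_lin _ P P' : {linear _ -> _}) fs.
have [h' h'E] := hP' _ _ f (g \o @inr_lin _ P P' : {linear _ -> _}) fs.
exists (copair_lin h h') => -[x y] /=; rewrite linearD hE h'E /= -linearD.
by congr (g _); congr pair; rewrite /= ?addr0 ?add0r.
Qed.

Lemma rV_isomorphic_dsum n :
  isomorphic 'rV[R]_n (dsum (fun _ : 'I_n => R^o : lmodType R)).
Proof.
have fl : linear
    (fun x : 'rV[R]_n => (fun i => x 0 i) : dsum (fun _ : 'I_n => R^o : lmodType R)).
  by move=> a u v; apply: functional_extensionality_dep => i; rewrite !mxE.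
apply: (@cancel_isomorphic _ _ _ (mklin fl) (fun f => \row_i f i)) => x.
  by apply/rowP => i; rewrite mxE.
by apply: functional_extensionality_dep => i; rewrite /= mxE.
Qed.

End FreeModules.

(** * Modules over local rings *)

Section Units.
Variable R : comNzRingType.

(** Invertibility in a ring without a chosen inverse operation. *)
Definition invertible (x : R) : Prop := exists y, x * y = 1.

Lemma invertible1 : invertible 1. Proof. by exists 1; rewrite mulr1. Qed.

Lemma ideal_invertible (I : set R) x : ideal I -> invertible x -> I x -> I = setT.
Proof.
move=> [I0 hI] [y xy] Ix; apply/seteqP; split=> // z _.
by have := hI (z * y) x 0 Ix I0;
  rewrite addr0 /GRing.scale /= -mulrA [y * x]mulrC xy mulr1.
Qed.

(** Zorn's lemma; the empty set is admitted as the bound of the empty chain. *)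
Lemma ideal_in_maximal (I : set R) :
  ideal I -> ~ I 1 -> exists m, maximal_ideal m /\ I `<=` m.
Proof.
move=> idI I1.
pose P (A : set R) := ~ A 1 /\ (A = set0 \/ ideal A /\ I `<=` A).
have [F FP tot|A [[A1 PA] Amax]] := @Zorn_bigcup R P.
  split; first by case=> A FA A1; case: (FP A FA) => + _; apply.
  have [[A FA A0]|nF] := pselect (exists2 A, F A & A !=set0); last first.
    left; apply/seteqP; split=> // x [A FA Ax]; apply: nF.
    by exists A => //; exists x.
  have good B : F B -> B !=set0 -> ideal B /\ I `<=` B.
    by move=> FB [x Bx]; case: (FP B FB) => _ [B0|//]; rewrite B0 in Bx.
  right; have [[A00 _] IA] := good A FA A0; split; last first.
    by move=> x Ix; exists A => //; apply: IA.
  split=> [|a u v [B FB Bu] [C FC Cv]]; first by exists A.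
  have [BC|CB] := tot B C FB FC.
    exists C => //; have [[_ h] _] := good C FC (ex_intro _ v Cv).
    by apply: h => //; apply: BC.
  exists B => //; have [[_ h] _] := good B FB (ex_intro _ u Bu).
  by apply: h => //; apply: CB.
have A00 : A <> set0.
  move=> A00; apply: (Amax I); last by split=> //; right; split.
  by rewrite A00; split=> [|IA]; [exact: sub0set | case: (IA 0 (proj1 idI))].
case: PA => [//|[idA IA]]; exists A; split=> //; split=> //.
  by move=> AT; apply: A1; rewrite AT.
move=> B idB AB; have [B1|B1] := pselect (B 1).
  by right; apply: ideal_invertible B1 => //; exact: invertible1.
left; apply/seteqP; split=> //; apply: contrapT => BA.
apply: (Amax B); first by split.
by split=> //; right; split=> // x /IA /AB.
Qed.

Hypothesis locR : local_ring R.

(** In a local ring the non-invertible elements form an ideal. *)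
Lemma local_nonunits :
  exists2 m : set R, ideal m & forall x, m x <-> ~ invertible x.
Proof.
case: locR => m [[idm mT _] mU]; exists m => // x; split=> [mx ux|ux].
  by apply: mT; apply: ideal_invertible mx.
have idx : ideal [set y | exists z, y = x * z].
  split=> [|a u v [u' ->] [v' ->]]; first by exists 0; rewrite mulr0.
  by exists (a * u' + v'); rewrite mulrDr mulrCA.
have [|m' [/mU -> h]] := ideal_in_maximal idx.
  by case=> z e; apply: ux; exists z.
by apply: h; exists 1; rewrite mulr1.
Qed.

Lemma nonunit_sum n (c x : 'I_n -> R) :
  (forall i, ~ invertible (x i)) -> ~ invertible (\sum_i c i * x i).
Proof.
move=> hx; have [m [m0 hm] mP] := local_nonunits; apply/mP.
have mD u v : m u -> m v -> m (u + v).
  by move=> mu mv; have := hm 1 _ _ mu mv; rewrite scale1r.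
elim/big_ind: _ => // i _; have /mP mx := hx i.
by have := hm (c i) _ _ mx m0; rewrite addr0.
Qed.

Lemma invertible_subr x : ~ invertible x -> invertible (1 - x).
Proof.
move=> nx; apply: contrapT => nx1; have [m [m0 hm] mP] := local_nonunits.
suff /mP : m 1 by apply; exact: invertible1.
have /mP mx := nx; have /mP mx1 := nx1.
by have := hm 1 _ _ mx1 mx; rewrite scale1r subrK.
Qed.

End Units.

Section Generators.
Variable R : comNzRingType.
Implicit Types M N : lmodType R.

Lemma fg_min_generators M :
  finitely_generated M -> exists n, min_generators M n.
Proof.
move=> [n gn]; have ex : exists n, `[< generated_by M n >] by exists n; apply/asboolP.
exists (ex_minn ex); case: ex_minnP => k /asboolP gk kmin; split=> // l gl.
by apply: kmin; apply/asboolP.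
Qed.

Lemma generated_by_surj M N n (f : {linear M -> N}) :
  surjective_fun f -> generated_by M n -> generated_by N n.
Proof.
move=> fs [v hv]; exists (f \o v) => y.
have [x <-] := fs y; have [c ->] := hv x; exists c; rewrite linear_sum.
by apply: eq_bigr => i _; rewrite linearZ.
Qed.

Lemma min_generators_isomorphic M N n :
  isomorphic M N -> min_generators M n -> min_generators N n.
Proof.
move=> [f [g fK gK]] [gM mM]; split.
  by apply: generated_by_surj gM => y; exists (g y).
move=> k gN; apply: mM.
have [h [h' hK h'K]] := isomorphic_sym (ex_intro _ f (Bijective fK gK)).
by apply: generated_by_surj gN => y; exists (h' y).
Qed.

(** A relation between the members of a minimal generating family has no
    invertible coefficient. *)
Lemma min_generators_relation M n (v : 'I_n -> M) (x : 'I_n -> R) :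
  min_generators M n ->
  (forall y, exists c : 'I_n -> R, y = \sum_(i < n) c i *: v i) ->
  \sum_(i < n) x i *: v i = 0 -> forall i, ~ invertible (x i).
Proof.
move=> [_ nmin] gen rel j [y xy].
case: n v x nmin gen rel j y xy => [|n] v x nmin gen rel j y xy; first by case: j {xy}.
suff /nmin : generated_by M n by rewrite ltnn.
exists (fun i => v (lift j i)) => z; have [c ->] := gen z.
have vj : v j = \sum_(i < n) (- (y * x (lift j i))) *: v (lift j i).
  move: rel; rewrite (bigD1_ord j) //= => rel.
  have := congr1 ( *:%R y) rel; rewrite scalerDr scalerA mulrC xy scale1r scaler0.
  move/eqP; rewrite addr_eq0 => /eqP ->.
  by rewrite scaler_sumr -sumrN; apply: eq_bigr => i _; rewrite scalerA scaleNr.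
exists (fun i => c (lift j i) + c j * (- (y * x (lift j i)))).
rewrite (bigD1_ord j) //= vj scaler_sumr addrC -big_split /=.
by apply: eq_bigr => i _; rewrite scalerDl scalerA.
Qed.

(** Minimal generating numbers drop when a non-zero direct summand is split
    off; this is Nakayama's lemma in disguise. *)
Lemma min_generators_summand M N n p :
  local_ring R -> finitely_generated N -> ~ zero_module N ->
  min_generators (M * N)%type n -> min_generators M p -> (p < n)%N.
Proof.
move=> locR fgN N0 [[v hv] _] mM.
have gM x : exists c : 'I_n -> R, x = \sum_(i < n) c i *: (v i).1.
  have [c e] := hv (x, 0); exists c; rewrite -[x]/((x, 0 : N).1) e.
  by rewrite (raddf_sum fst).
rewrite ltn_neqAle (proj2 mM) ?andbT; last by exists (fst \o v).
apply/eqP => pn; subst p; have [q [[w hw] qmin]] := fg_min_generators fgN.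
have mN : forall y : N, exists2 c : 'I_n -> R,
    (forall i, ~ invertible (c i)) & y = \sum_(i < n) c i *: (v i).2.
  move=> y; have [c e] := hv (0, y); exists c; last first.
    by rewrite -[y]/((0 : M, y).2) e (raddf_sum snd).
  apply: (min_generators_relation mM gM).
  by rewrite -[RHS]/((0 : M, y).1) e (raddf_sum fst).
case: q w hw qmin => [|q] w hw qmin.
  by apply: N0 => y; have [c ->] := hw y; rewrite big_ord0.
have [c cn cE] := mN (w ord0).
have [a aE] := choice (fun i => hw (v i).2).
pose d j := \sum_(i < n) a i j * c i.
have dn j : ~ invertible (d j) by apply: nonunit_sum.
have wE : w ord0 = \sum_j d j *: w j.
  rewrite cE; under [RHS]eq_bigr => j _ do rewrite scaler_suml.
  rewrite exchange_big /=; apply: eq_bigr => i _; rewrite [in LHS]aE scaler_sumr.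
  by apply: eq_bigr => j _; rewrite scalerA mulrC.
have rel : \sum_j ((j == ord0)%:R - d j) *: w j = 0.
  under eq_bigr => j _ do rewrite scalerBl.
  rewrite sumrB -wE (bigD1 ord0) //= scale1r big1 ?addr0 ?subrr //.
  by move=> j /negPf ->; rewrite scale0r.
have mq : min_generators N q.+1 by split=> //; exists w.
have := min_generators_relation (i := ord0) mq hw rel; rewrite eqxx; apply.
exact: invertible_subr.
Qed.

Lemma min_generators0 M : min_generators M 0 -> zero_module M.
Proof. by case=> [[v hv] _] x; have [c ->] := hv x; rewrite big_ord0. Qed.

End Generators.

(** * Submodules, kernels and cokernels *)

Lemma span_submodule (R : comNzRingType) (V : lmodType R) (S : set V) x :
  submodule S -> (x \in span_pred S) <-> S x.
Proof.
move=> sS; split=> [/asboolP h|Sx]; first exact: h.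
by apply/asboolP => T _; apply.
Qed.

Section Submodule.
Variables (R : comNzRingType) (V : lmodType R) (S : set V).

(** The submodule generated by [S], as a module of its own. *)
Record subm := Subm { subm_val : V; submP : subm_val \in span_pred S }.

HB.instance Definition _ := [isSub for subm_val].
HB.instance Definition _ := [Choice of subm by <:].
HB.instance Definition _ := [SubChoice_isSubLmodule of subm by <:].

Lemma subm_val_linear : linear subm_val.
Proof. exact: (linearP (val : {linear subm -> V})). Qed.

End Submodule.

Section KernelCokernel.
Variable R : comNzRingType.
Implicit Types A L M N : lmodType R.

Lemma exists_kernel M N (p : {linear M -> N}) :
  surjective_fun p ->
  exists (K : lmodType R) (i : {linear K -> M}), short_exact i p.
Proof.
move=> ps; pose S := p @^-1` [set 0].
have sS : submodule S.
  split=> [|a u v pu pv]; first exact: (raddf0 p).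
  by rewrite /S /= linearP pu pv scaler0 addr0.
exists (subm S : lmodType R), (mklin (@subm_val_linear R M S)).
apply: short_exactI => //=.
- exact: val_inj.
- by move=> x; have /(span_submodule _ sS) := submP x.
- by move=> y py; have /(span_submodule _ sS) Sy : S y by []; exists (Subm Sy).
Qed.

Lemma exists_cokernel L M (i : {linear L -> M}) :
  injective i ->
  exists (N : lmodType R) (p : {linear M -> N}), short_exact i p.
Proof.
move=> ii; have sS : submodule (range i).
  split=> [|a u v [x _ <-] [y _ <-]]; first by exists 0; rewrite ?raddf0.
  by exists (a *: x + y); rewrite ?linearP.
exists (quotmod (range i) : lmodType R), (@quot_proj _ _ (range i)).
apply: short_exactI => //.
- move=> x; apply/eqP; rewrite quot_proj_eq0; apply/(span_submodule _ sS).
  by exists x.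
- by move=> y /eqP; rewrite quot_proj_eq0 => /(span_submodule _ sS) [x _ <-]; exists x.
- exact: quot_proj_surj.
Qed.

(** The finite generation of a submodule, expressed inside the ambient module. *)
Definition fg_submodule (V : lmodType R) (S : set V) : Prop :=
  exists n (w : 'I_n -> V), (forall i, S (w i)) /\
    forall x, S x -> exists c : 'I_n -> R, x = \sum_(i < n) c i *: w i.

Hypothesis noethR : noetherian R.

(** By induction on [n]: the first coordinates of the elements of [S] form an
    ideal, and the elements with first coordinate 0 lie in a smaller free
    module. *)
Lemma noetherian_rV n (S : set 'rV[R]_n) : submodule S -> fg_submodule S.
Proof.
elim: n S => [|n IH] S [S0 hS].
  exists 0%N, (fun=> 0); split=> [[]//|x _]; exists (fun=> 0).
  by rewrite big_ord0; apply/rowP; case.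
have SD u v : S u -> S v -> S (u + v).
  by move=> Su Sv; have := hS 1 _ _ Su Sv; rewrite scale1r.
have SZ a u : S u -> S (a *: u).
  by move=> Su; have := hS a _ _ Su S0; rewrite addr0.
have Ssum m (w : 'I_m -> 'rV_n.+1) c : (forall i, S (w i)) -> S (\sum_(i < m) c i *: w i).
  by move=> Sw; elim/big_ind: _ => // i _; apply: SZ.
have idI : ideal [set a | exists2 x, S x & x 0 0 = a].
  split=> [|a u v [x Sx <-] [y Sy <-]]; first by exists 0; rewrite ?mxE.
  by exists (a *: x + y); [exact: hS | rewrite !mxE].
have [k [a aE]] := noethR idI.
have Ia i : exists2 x, S x & x 0 0 = a i.
  suff : [set a | exists2 x, S x & x 0 0 = a] (a i) by [].
  rewrite aE; exists (fun j => (i == j)%:R).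
  rewrite (bigD1 i) //= eqxx mul1r big1 ?addr0 // => j.
  by rewrite eq_sym => /negPf ->; rewrite mul0r.
pose s i := s2val (cid2 (Ia i)).
have Ss i : S (s i) := s2valP (cid2 (Ia i)).
have sa i : s i 0 0 = a i := s2valP' (cid2 (Ia i)).
have rl : linear (fun y : 'rV[R]_n => row_mx 0 y : 'rV[R]_(1 + n)).
  by move=> b u v; rewrite scale_row_mx add_row_mx scaler0 addr0.
pose r : {linear 'rV[R]_n -> 'rV[R]_n.+1} := mklin rl.
have [|m [w [Sw wE]]] := IH [set y | S (r y)].
  split=> [|b u v Su Sv]; first by rewrite /= -[S _]/(S (r 0)) raddf0.
  by rewrite /= -[S _]/(S (r (b *: u + v))) linearP; apply: hS.
pose w' i := r (w i).
exists (k + m)%N, (fun i => match split i with inl j => s j | inr j => w' j end).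
have spl i : split (lshift m i) = inl i := unsplitK (inl i).
have spr j : split (rshift k j) = inr j := unsplitK (inr j).
split=> [i|x Sx]; first by case: (split i) => j //; apply: Sw.
have : [set a | exists2 x, S x & x 0 0 = a] (x 0 0) by exists x.
rewrite aE => -[c cE].
pose y := x - \sum_(i < k) c i *: s i.
have Sy : S y by rewrite /y -scaleN1r; apply: SD => //; apply: SZ; apply: Ssum.
have y0 : y = r (rsubmx (y : 'rV_(1 + n))).
  have l0 : lsubmx (y : 'rV_(1 + n)) = 0.
    apply/rowP => j; rewrite !mxE ord1 (_ : lshift n 0 = 0); last exact: val_inj.
    by rewrite cE summxE -sumrB big1 // => i _; rewrite !mxE sa subrr.
  by rewrite -[LHS](hsubmxK (y : 'rV_(1 + n))) l0.
have [d dE] : exists c : 'I_m -> R, rsubmx (y : 'rV_(1 + n)) = \sum_(i < m) c i *: w i.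
  apply: wE; suff : S (r (rsubmx (y : 'rV_(1 + n)))) by [].
  by rewrite -y0.
exists (fun i => match split i with inl j => c j | inr j => d j end).
rewrite big_split_ord /=.
under eq_bigr => i _ do rewrite spl.
under [X in _ = _ + X]eq_bigr => i _ do rewrite spr.
rewrite -[LHS](subrK (\sum_(i < k) c i *: s i)) addrC -/y y0 dE linear_sum.
by congr (_ + _); apply: eq_bigr => i _; rewrite linearZ.
Qed.

(** The dual of a finitely generated module over a noetherian ring is finitely
    generated, since it embeds into a free module by evaluation at generators. *)
Lemma noetherian_dual_fg A : finitely_generated A ->
  exists a (f : 'I_a -> {linear A -> (R^o : lmodType R)}),
    forall g : {linear A -> (R^o : lmodType R)},
      exists c : 'I_a -> R, forall x, g x = \sum_(k < a) c k * f k x.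
Proof.
move=> [n [v hv]].
pose S := [set x : 'rV[R]_n |
  exists f : {linear A -> (R^o : lmodType R)}, forall i, x 0 i = f (v i)].
have sS : submodule S.
  split=> [|b x y [f fE] [g gE]].
    by exists (\0 : {linear A -> R^o}) => i; rewrite mxE.
  exists ((b \*: f) \+ g : {linear A -> R^o}) => i.
  by rewrite !mxE fE gE.
have [a [w [Sw wE]]] := noetherian_rV sS.
pose f k := sval (cid (Sw k)).
have fE k i : w k 0 i = f k (v i) := svalP (cid (Sw k)) i.
exists a, f => g; have Sg : S (\row_i g (v i)) by exists g => i; rewrite mxE.
have [c cE] := wE _ Sg; exists c => x; have [b ->] := hv x.
have gE i : g (v i) = \sum_(k < a) c k * f k (v i).
  have := congr1 (fun z : 'rV_n => z 0 i) cE; rewrite mxE summxE => ->.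
  by apply: eq_bigr => k _; rewrite mxE fE.
rewrite linear_sum; under eq_bigr => i _ do rewrite linearZ gE /= /GRing.scale /= mulr_sumr.
rewrite exchange_big /=; apply: eq_bigr => k _.
rewrite linear_sum mulr_sumr; apply: eq_bigr => i _.
by rewrite linearZ /GRing.scale /= mulrCA.
Qed.

(** Syzygies of finitely generated modules are finitely generated. *)
Lemma ker_fg L N n (i : {linear L -> 'rV[R]_n}) (p : {linear 'rV[R]_n -> N}) :
  short_exact i p -> finitely_generated L.
Proof.
move=> ex; have sS : submodule (range i).
  split=> [|a u v [x _ <-] [y _ <-]]; first by exists 0; rewrite ?raddf0.
  by exists (a *: x + y); rewrite ?linearP.
have [k [w [Sw wE]]] := noetherian_rV sS.
have hw j : exists x, i x = w j by have [x _ e] := Sw j; exists x.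
pose s j := sval (cid (hw j)).
have sE j : i (s j) = w j := svalP (cid (hw j)).
exists k, s => x; have [|c cE] := wE (i x); first by exists x.
exists c; apply: (ses_inj ex); rewrite cE linear_sum.
by apply: eq_bigr => j _; rewrite linearZ sE.
Qed.

End KernelCokernel.

(** * The monoid of isomorphism classes *)

Section ClassMonoid.
Variable R : comNzRingType.
Implicit Types (c d : mclasses R) (M N : fgmod R).

(** A module in a given class. *)
Definition crep c : fgmod R := sval (cid (mclass_surj c)).

Lemma crepK c : mclass (crep c) = c.
Proof. by rewrite -(svalP (cid (mclass_surj c))). Qed.

Lemma crep_iso M : isomorphic (crep (mclass M)) M.
Proof. by apply/mclassP; rewrite crepK. Qed.

Definition class_zero : mclasses R := mclass (FGMod (fg_rV R 0)).

(** The sum of two classes is the class of the direct sum. *)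
Definition class_add c d : mclasses R := mclass (fgmod_dsum (crep c) (crep d)).

Lemma class_addE M N : class_add (mclass M) (mclass N) = mclass (fgmod_dsum M N).
Proof. by apply/mclassP; apply: isomorphic_prod; exact: crep_iso. Qed.

Lemma class_addA : associative class_add.
Proof.
move=> a b c; rewrite -(crepK a) -(crepK b) -(crepK c) !class_addE.
exact/mclassP/isomorphic_prodA.
Qed.

Lemma class_addC : commutative class_add.
Proof. by move=> a b; exact/mclassP/isomorphic_prodC. Qed.

Lemma class_add0 : left_id class_zero class_add.
Proof.
move=> a; rewrite -(crepK a) class_addE; apply/mclassP/isomorphic_prod0.
by move=> x; apply/rowP; case.
Qed.

HB.instance Definition _ :=
  GRing.isNmodule.Build (mclasses R) class_addA class_addC class_add0.

Lemma mclassD M N : mclass (fgmod_dsum M N) = mclass M + mclass N.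
Proof. by rewrite -class_addE. Qed.

Lemma crepD c d : isomorphic (crep (c + d)) (crep c * crep d)%type.
Proof. by rewrite -{1}(crepK c) -{1}(crepK d) -mclassD; exact: crep_iso. Qed.

Lemma mclass0P M : mclass M = 0 <-> zero_module M.
Proof.
have z0 : zero_module 'rV[R]_0 by move=> x; apply/rowP; case.
split=> [/mclassP e|M0]; last by apply/mclassP; exact: zero_modules_isomorphic.
by apply: zero_isomorphic z0; exact: isomorphic_sym.
Qed.

Lemma crep0P c : zero_module (crep c) <-> c = 0.
Proof. by rewrite -{2}(crepK c) mclass0P. Qed.

(** The atoms of the monoid of classes, that is, the classes of the non-zero
    indecomposable modules (see [atom_indecomposable]). *)
Definition atom c : Prop :=
  c != 0 /\ forall a b, c = a + b -> a = 0 \/ b = 0.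

Lemma atom_indecomposable M :
  atom (mclass M) <-> indecomposable M /\ ~ zero_module M.
Proof.
split=> [[M0 hM]|[iM M0]].
  split; last by move/mclass0P/eqP; exact/negP.
  move=> N L e; have [f [g fK gK]] := e.
  have fgN : finitely_generated N.
    apply: (@surjective_fg R M N (fst \o f : {linear _ -> _})) (fgmodP M) => y.
    by exists (g (y, 0)); rewrite /= gK.
  have fgL : finitely_generated L.
    apply: (@surjective_fg R M L (snd \o f : {linear _ -> _})) (fgmodP M) => y.
    by exists (g (0, y)); rewrite /= gK.
  have /hM : mclass M = mclass (FGMod fgN) + mclass (FGMod fgL).
    by rewrite -mclassD; apply/mclassP.
  by case=> /mclass0P; [left | right].
split; first by apply/eqP => /mclass0P.
move=> a b e; have e' : isomorphic M (crep a * crep b)%type.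
  apply: isomorphic_trans (crepD a b); apply/mclassP.
  by rewrite crepK.
by case: (iM _ _ e') => /crep0P; [left | right].
Qed.

Lemma dsum_recl n (M : 'I_n.+1 -> lmodType R) :
  isomorphic (dsum M) (M ord0 * dsum (fun i => M (lift ord0 i)))%type.
Proof.
have fl : linear (fun f : dsum M =>
    (f ord0, (fun i => f (lift ord0 i)) : dsum (fun i => M (lift ord0 i)))).
  by [].
pose g (x : M ord0 * dsum (fun i => M (lift ord0 i))) : dsum M :=
  fun i => match unliftP ord0 i with
           | UnliftSome j e => eq_rect_r (fun k => M k : Type) (x.2 j) e
           | UnliftNone e => eq_rect_r (fun k => M k : Type) x.1 e
           end.
apply: (@cancel_isomorphic _ _ _ (mklin fl) g).
  move=> f; apply: functional_extensionality_dep => i; rewrite /g /=.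
  by case: unliftP => [j e|e]; subst i.
case=> x f; rewrite /= /g; congr pair.
  case: unliftP => [j e|e]; last by rewrite [e]eq_axiomK.
  by case/eqP: (neq_lift ord0 j).
apply: functional_extensionality_dep => i.
case: unliftP => [j e|e]; last by case/eqP: (neq_lift ord0 i).
have ij := lift_inj e; subst j; by rewrite [e]eq_axiomK.
Qed.

Lemma dsum_class n (M : 'I_n -> fgmod R) :
  isomorphic (crep (\sum_(i < n) mclass (M i))) (dsum (fun i => M i : lmodType R)).
Proof.
elim: n M => [|n IH] M.
  rewrite big_ord0; apply: zero_modules_isomorphic; first exact/crep0P.
  by move=> f; apply: functional_extensionality_dep; case.
apply: isomorphic_trans (isomorphic_sym (dsum_recl _)).
rewrite big_ord_recl; apply: isomorphic_trans (crepD _ _) _.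
by apply: isomorphic_prod; [exact: crep_iso | exact: IH].
Qed.

End ClassMonoid.

(** * Unique decomposition *)

Section Decomposition.
Variable R : comNzRingType.
Hypothesis locR : local_ring R.
Implicit Types c d s : mclasses R.

(** By induction on the number of generators, which drops when a non-zero summand
    is split off. *)
Lemma decomposition_exists c :
  exists l, (forall s, s \in l -> atom s) /\ c = \sum_(s <- l) s.
Proof.
have [n hn] := fg_min_generators (fgmodP (crep c)).
have [k] := ubnP n; elim: k n c hn => // k IH n c hn; rewrite ltnS => nk.
have [->|c0] := eqVneq c 0; first by exists [::]; rewrite big_nil.
have [ca|nca] := pselect (atom c).
  by exists [:: c]; rewrite big_seq1; split=> // s; rewrite inE => /eqP ->.
have [a [b [e a0 b0]]] : exists a b, [/\ c = a + b, a <> 0 & b <> 0].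
  apply: contrapT => h; apply: nca; split=> // a b e.
  have [->|a0] := pselect (a = 0); first by left.
  have [->|b0] := pselect (b = 0); first by right.
  by case: h; exists a, b.
have split_lt a' b' : c = a' + b' -> b' <> 0 ->
    exists l, (forall s, s \in l -> atom s) /\ a' = \sum_(s <- l) s.
  move=> e' b'0; have [p hp] := fg_min_generators (fgmodP (crep a')).
  apply: (IH p) => //; apply: leq_trans nk.
  apply: (min_generators_summand locR (fgmodP (crep b'))) hp.
    by move/crep0P.
  by apply: min_generators_isomorphic hn; rewrite e'; exact: crepD.
have [l [la lE]] := split_lt _ _ e b0.
have [l' [l'a l'E]] := split_lt b a (etrans e (addrC _ _)) a0.
exists (l ++ l'); split; last by rewrite big_cat e lE l'E.
by move=> s; rewrite mem_cat => /orP[/la|/l'a].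
Qed.

(** The indecomposable summands in a chosen decomposition. *)
Definition summands c : seq (mclasses R) := sval (cid (decomposition_exists c)).

Lemma summands_atom c s : s \in summands c -> atom s.
Proof. exact: (proj1 (svalP (cid (decomposition_exists c)))). Qed.

Lemma summandsE c : c = \sum_(s <- summands c) s.
Proof. exact: (proj2 (svalP (cid (decomposition_exists c)))). Qed.

Hypothesis krsR : krull_remak_schmidt R.

(** The Krull-Remak-Schmidt property, for classes. *)
Lemma decomposition_unique (l l' : seq (mclasses R)) :
  (forall s, s \in l -> atom s) -> (forall s, s \in l' -> atom s) ->
  \sum_(s <- l) s = \sum_(s <- l') s -> perm_eq l l'.
Proof.
move=> la l'a e.
pose M (i : 'I_(size l)) := crep l`_i; pose N (i : 'I_(size l')) := crep l'`_i.
have atomM (s : mclasses R) : atom s -> [/\ finitely_generated (crep s),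
    indecomposable (crep s) & ~ zero_module (crep s)].
  rewrite -{1}(crepK s) => /atom_indecomposable[h1 h2]; split=> //.
  exact: fgmodP.
have [| | |sz [f [bf fP]]] := @krsR _ _ (fun i => M i) (fun i => N i).
- by move=> i; apply/atomM/la; rewrite mem_nth.
- by move=> i; apply/atomM/l'a; rewrite mem_nth.
- have h := dsum_class M; have h' := dsum_class N.
  apply: isomorphic_trans (isomorphic_sym h) _; apply: isomorphic_trans h'.
  rewrite (eq_bigr (fun i : 'I_(size l) => l`_i)); last by move=> i _; rewrite crepK.
  rewrite [X in isomorphic _ (crep X)](eq_bigr (fun i : 'I_(size l') => l'`_i));
    last by move=> i _; rewrite crepK.
  have sumE (k : seq (mclasses R)) : \sum_(i < size k) k`_i = \sum_(s <- k) s.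
    by rewrite (big_nth 0) big_mkord.
  by rewrite !sumE e; exact: isomorphic_refl.
have fE (i : 'I_(size l)) : l`_i = l'`_(f i).
  have /mclassP := fP i; by rewrite !crepK.
have lE (k : seq (mclasses R)) :
    k = [seq k`_(i : 'I_(size k)) | i <- enum 'I_(size k)].
  by rewrite -[LHS](mkseq_nth 0) /mkseq -val_enum_ord -map_comp.
rewrite (lE l) (lE l') (eq_map fE) (map_comp (fun i : 'I_(size l') => l'`_i) f).
apply: perm_map; apply: uniq_perm; rewrite ?(map_inj_uniq (bij_inj bf)) ?enum_uniq //.
move=> j; rewrite mem_enum; apply/mapP.
by case: bf => g fK gK; exists (g j); rewrite ?mem_enum ?gK.
Qed.

(** The multiplicity of [s] as an indecomposable summand of [c]; it does not
    depend on the decomposition by [mult_decomposition]. *)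
Definition mult s c : nat := count_mem s (summands c).

Lemma mult_decomposition s (l : seq (mclasses R)) :
  (forall s, s \in l -> atom s) -> mult s (\sum_(s <- l) s) = count_mem s l.
Proof.
move=> la; apply/permP; apply: decomposition_unique => //.
  exact: summands_atom.
by rewrite -summandsE.
Qed.

Lemma mult_atom s a : atom a -> mult s a = (a == s) :> nat.
Proof.
move=> aa; rewrite -[in LHS](big_seq1 +%R a id) mult_decomposition /= ?addn0 //.
by move=> x; rewrite inE => /eqP ->.
Qed.

Lemma multD s c d : mult s (c + d) = (mult s c + mult s d)%N.
Proof.
rewrite {1}(summandsE c) {1}(summandsE d) -big_cat mult_decomposition ?count_cat //.
by move=> x; rewrite mem_cat => /orP[]; exact: summands_atom.
Qed.

Lemma mult0 s : mult s 0 = 0%N.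
Proof. by apply: (@addnI (mult s 0)); rewrite -multD addr0 addn0. Qed.

Lemma multMn s c n : mult s (c *+ n) = (mult s c * n)%N.
Proof.
by elim: n => [|n IH]; rewrite ?mulr0n ?mult0 ?muln0 // mulrS multD IH mulnS.
Qed.

Lemma mult_inj c d : (forall s, mult s c = mult s d) -> c = d.
Proof.
move=> h; rewrite (summandsE c) (summandsE d); apply: perm_big.
by apply/allP => s _; apply/eqP/h.
Qed.

Lemma addcI a : injective (fun c : mclasses R => a + c).
Proof.
by move=> c d /= e; apply: mult_inj => s; have := congr1 (mult s) e;
  rewrite !multD => /addnI.
Qed.

Lemma atom_mult c : c != 0 -> exists2 s, atom s & (0 < mult s c)%N.
Proof.
rewrite /mult; have := summandsE c; have := @summands_atom c.
case: summands => [|s l] la ->; first by rewrite big_nil eqxx.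
by exists s; [apply: la; rewrite mem_head | rewrite /= eqxx].
Qed.

Lemma mult_summand s c : (0 < mult s c)%N -> atom s /\ exists d, c = s + d.
Proof.
rewrite -has_count => /hasP[x xc /= /eqP ?]; subst x; split.
  exact: summands_atom xc.
exists (\sum_(x <- rem s (summands c)) x).
rewrite [LHS]summandsE (perm_big _ (perm_to_rem xc)).
by rewrite big_cons.
Qed.

(** * Stable classes *)

Lemma fg_regular : finitely_generated (R^o : lmodType R).
Proof.
exists 1%N, (fun=> 1) => x; exists (fun=> x).
by rewrite big_ord1 /GRing.scale /= mulr1.
Qed.

(** The class of the free module of rank one. *)
Definition rho : mclasses R := mclass (FGMod fg_regular).

Lemma atom_rho : atom rho.
Proof.
split.
  apply/eqP => /mclass0P h; have := h (1 : R) => /= /eqP.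
  by rewrite oner_eq0.
move=> a b e; have [n mn] := fg_min_generators fg_regular.
have n1 : (n <= 1)%N.
  apply: (proj2 mn); exists (fun=> 1) => x; exists (fun=> x).
  by rewrite big_ord1 /GRing.scale /= mulr1.
have [->|b0] := pselect (b = 0); first by right.
left; apply/crep0P; have [p hp] := fg_min_generators (fgmodP (crep a)).
have : (p < n)%N.
  apply: (min_generators_summand locR (fgmodP (crep b))) hp; first by move/crep0P.
  apply: min_generators_isomorphic mn; apply: isomorphic_trans (crepD a b).
  by rewrite -e; exact/isomorphic_sym/(crep_iso (FGMod fg_regular)).
by case: n n1 {mn} => [|[|n]] // _; case: p hp => // /min_generators0.
Qed.

Lemma class_rV n (F : finitely_generated 'rV[R]_n) : mclass (FGMod F) = rho *+ n.
Proof.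
have -> : rho *+ n = \sum_(i < n) rho by rewrite sumr_const card_ord.
rewrite -[RHS]crepK; apply/mclassP; apply: isomorphic_sym.
apply: isomorphic_trans (dsum_class _) _.
exact/isomorphic_sym/rV_isomorphic_dsum.
Qed.

(** Two classes are stably equal when they agree up to free summands. *)
Definition stable_eq c d : Prop := forall s, s != rho -> mult s c = mult s d.

Lemma stable_sym c d : stable_eq c d -> stable_eq d c.
Proof. by move=> h s /h. Qed.

Lemma stable_trans c d e : stable_eq c d -> stable_eq d e -> stable_eq c e.
Proof. by move=> h h' s hs; rewrite h ?h'. Qed.

Lemma stable_free c n : stable_eq (c + rho *+ n) c.
Proof.
move=> s hs; rewrite multD multMn (mult_atom s atom_rho).
by rewrite eq_sym (negPf hs) mul0n addn0.
Qed.

Lemma stable_add_free c d :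
  stable_eq c d -> c + rho *+ mult rho d = d + rho *+ mult rho c.
Proof.
move=> h; apply: mult_inj => s.
rewrite !multD !multMn (mult_atom s atom_rho).
have [<-|hs] := eqVneq rho s; first by rewrite !mul1n addnC.
by rewrite h // eq_sym.
Qed.

Lemma stable0_free c : stable_eq c 0 -> c = rho *+ mult rho c.
Proof.
by move/stable_add_free; rewrite mult0 mulr0n addr0 add0r.
Qed.

(** Finitely generated projective modules are free, since they are summands of
    free modules. *)
Lemma projective_class (P : fgmod R) :
  projective P -> exists k, mclass P = rho *+ k.
Proof.
move=> pP; have [n [v hv]] := fgmodP P.
have ps := lincomb_surj hv; have [K [i ex]] := exists_kernel ps.
have ex' : short_exact (\0 : {linear 'rV[R]_0 -> P}) (idfun : {linear P -> P}).
  apply: short_exactI => //; first by move=> x y _; apply/rowP; case.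
    by move=> y /= ->; exists 0.
  by move=> y; exists y.
have [f bf] := schanuel (@projective_rV R n) pP ex ex'.
have fK : finitely_generated K.
  have [g [g' gK g'K]] := isomorphic_sym (ex_intro _ f bf).
  apply: (@surjective_fg R _ _ (fst \o g : {linear _ -> K})).
    by move=> y; exists (g' (y, 0)); rewrite /= g'K.
  exact: (fg_prod (FGMod (fg_rV R 0)) (FGMod (fg_rV R n))).
have /mclassP e : isomorphic (fgmod_dsum (FGMod fK) P)
  (fgmod_dsum (FGMod (fg_rV R 0)) (FGMod (fg_rV R n))) by exists f.
rewrite !mclassD !class_rV mulr0n add0r in e.
exists (mult rho (mclass P)); apply: stable0_free => s hs.
have := congr1 (mult s) e; have := stable_free 0 n hs.
by rewrite add0r multD mult0 => -> /eqP; rewrite addn_eq0 => /andP[_ /eqP].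
Qed.

End Decomposition.

(** * Syzygies *)

Section Syzygies.
Variable R : comNzRingType.
Hypothesis noethR : noetherian R.
Hypothesis locR : local_ring R.
Hypothesis krsR : krull_remak_schmidt R.
Implicit Types c d s : mclasses R.

Local Notation mult := (mult locR).
Local Notation rho := (rho R).
Local Notation "c =st= d" := (stable_eq locR c d) (at level 70).

Lemma min_generators_cover (M : lmodType R) m :
  min_generators M m -> exists p : {linear 'rV[R]_m -> M}, surjective_fun p.
Proof. by case=> [[v hv] _]; exists (lincomb v); exact: lincomb_surj. Qed.

Lemma syzygy_fg (M N : lmodType R) : syzygy M N -> finitely_generated N.
Proof. by case=> m [_ [i [p ex]]]; exact: (ker_fg noethR ex). Qed.

Lemma syzygy_exists (M : fgmod R) : exists N : fgmod R, syzygy M N.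
Proof.
have [m mM] := fg_min_generators (fgmodP M).
have [p ps] := min_generators_cover mM; have [K [i ex]] := exists_kernel ps.
have sK : syzygy M K by exists m; split=> //; exists i, p.
by exists (FGMod (syzygy_fg sK)).
Qed.

(** The class of the minimal syzygy of the modules in a given class. *)
Definition om c : mclasses R := mclass (sval (cid (syzygy_exists (crep c)))).

(** The outer terms of a short exact sequence can be replaced by isomorphic ones. *)
Lemma ses_transport (L M N L' N' : lmodType R) (i : {linear L -> M})
    (p : {linear M -> N}) :
  short_exact i p -> isomorphic L L' -> isomorphic N N' ->
  exists (i' : {linear L' -> M}) (p' : {linear M -> N'}), short_exact i' p'.
Proof.
move=> ex eL [h [k hK kK]]; have [f [g fK gK]] := isomorphic_sym eL.
exists (i \o f : {linear _ -> _}), (h \o p : {linear _ -> _}).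
apply: short_exactI.
- by move=> x y /= /(ses_inj ex) /(can_inj fK).
- by move=> x /=; rewrite (ses_comp ex) raddf0.
- move=> y /= hpy; have /(ses_ker ex)[x <-] : p y = 0.
    by apply: (can_inj hK); rewrite hpy raddf0.
  by exists (g x); rewrite /= gK.
- by move=> y; have [x e] := ses_surj ex (k y); exists x; rewrite /= e kK.
Qed.

Lemma om_syzygy c : syzygy (crep c) (crep (om c)).
Proof.
rewrite /om; case: cid => N /= [m [mM [i [p ex]]]]; exists m; split=> //.
apply: (ses_transport ex); last exact: isomorphic_refl.
exact/isomorphic_sym/crep_iso.
Qed.

Lemma om_ses c : exists m (i : {linear crep (om c) -> 'rV[R]_m})
  (p : {linear 'rV[R]_m -> crep c}), short_exact i p.
Proof. by have [m [_ [i [p ex]]]] := om_syzygy c; exists m, i, p. Qed.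

Lemma schanuel_class (N P M N' P' M' : fgmod R) (i : {linear N -> P})
    (p : {linear P -> M}) (i' : {linear N' -> P'}) (p' : {linear P' -> M'}) :
  projective P -> projective P' -> short_exact i p -> short_exact i' p' ->
  mclass M = mclass M' -> mclass N + mclass P' = mclass N' + mclass P.
Proof.
move=> pP pP' ex ex' /mclassP e.
have [j [q ex1]] := ses_transport ex (isomorphic_refl N) e.
by rewrite -!mclassD; apply/mclassP; exact: schanuel ex1 ex'.
Qed.

(** Minimal syzygies are unique, since free modules can be cancelled. *)
Lemma syzygy_class (M N : fgmod R) : syzygy M N -> mclass N = om (mclass M).
Proof.
move=> [m [mM [i [p ex]]]]; have [k [mc [j [q ex']]]] := om_syzygy (mclass M).
have km : k = m.
  have mM' := min_generators_isomorphic (crep_iso M) mc.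
  by apply/eqP; rewrite eqn_leq (proj2 mM) ?(proj2 mM') //; [case: mM | case: mM'].
subst k; have := @schanuel_class N (FGMod (fg_rV R m)) M (crep (om (mclass M)))
  (FGMod (fg_rV R m)) (crep (mclass M)) i p j q (@projective_rV R m)
  (@projective_rV R m) ex ex' (esym (crepK _)).
by rewrite crepK ![_ + mclass (FGMod (fg_rV R m))]addrC => /(addcI locR krsR).
Qed.

(** The syzygy computed from any presentation by a projective module is stably
    the minimal one. *)
Lemma om_stable_unique (N P M : fgmod R) (i : {linear N -> P})
    (p : {linear P -> M}) :
  projective P -> short_exact i p -> om (mclass M) =st= mclass N.
Proof.
move=> pP ex; have [m [j [q ex']]] := om_ses (mclass M).
have := @schanuel_class N P M (crep (om (mclass M))) (FGMod (fg_rV R m))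
  (crep (mclass M)) i p j q pP (@projective_rV R m) ex ex' (esym (crepK _)).
have [k ->] := projective_class locR krsR pP; rewrite class_rV crepK => e.
apply: stable_trans _ (stable_free locR krsR (mclass N) m); rewrite e.
exact/stable_sym/(stable_free locR krsR).
Qed.

(** The minimal syzygy of a free module is zero and not only stably zero. *)
Lemma om_free n : om (rho *+ n) = 0.
Proof.
have z0 : zero_module 'rV[R]_0 by move=> x; apply/rowP; case.
rewrite -(class_rV (fg_rV R n)) -(@syzygy_class _ (FGMod (fg_rV R 0))) //=.
exists n; split.
  split; first by exists (fun i => delta_mx 0 i) => x; exists (fun i => x 0 i);
    exact: row_sum_delta.
  move=> k [v hv]; have [c cE] := choice (fun i => hv (delta_mx 0 i)).
  apply: (@mulmx1_min R n k (\matrix_(i, j) c i j) (\matrix_(j, l) v j 0 l)).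
  apply/matrixP => i l; rewrite !mxE.
  have := congr1 (fun x : 'rV_n => x 0 l) (cE i); rewrite mxE summxE eqxx /=.
  rewrite eq_sym => ->; apply: eq_bigr => j _; by rewrite !mxE.
exists (\0 : {linear 'rV[R]_0 -> 'rV[R]_n}), (idfun : {linear _ -> _}).
apply: short_exactI => //.
- by move=> x y _; rewrite [x]z0 [y]z0.
- by move=> y /= ->; exists 0.
- by move=> y; exists y.
Qed.

Lemma om0 : om 0 = 0.
Proof. exact: (om_free 0). Qed.

Lemma omD c d : om (c + d) =st= om c + om d.
Proof.
have [m [i [p ex]]] := om_ses c; have [n [j [q ex']]] := om_ses d.
have := @om_stable_unique (fgmod_dsum (crep (om c)) (crep (om d)))
  (fgmod_dsum (FGMod (fg_rV R m)) (FGMod (fg_rV R n)))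
  (fgmod_dsum (crep c) (crep d)) _ _
  (projective_prod (@projective_rV R m) (@projective_rV R n))
  (short_exact_prod ex ex').
by rewrite !mclassD !crepK.
Qed.

Lemma om_stable c d : c =st= d -> om c =st= om d.
Proof.
move=> /(stable_add_free krsR) e.
have h a n : om (a + rho *+ n) =st= om a.
  by apply: stable_trans (omD _ _) _; rewrite om_free addr0.
apply: stable_trans _ (h d (mult rho c)); rewrite -e.
exact/stable_sym/h.
Qed.

Lemma iter_omD k c d : iter k om (c + d) =st= iter k om c + iter k om d.
Proof.
elim: k => [|k IH] //; rewrite !iterS.
exact: stable_trans (om_stable IH) (omD _ _).
Qed.

Lemma iter_om0 k : iter k om 0 = 0.
Proof. by elim: k => //= k ->; exact: om0. Qed.

Lemma iter_om_stable k c d : c =st= d -> iter k om c =st= iter k om d.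
Proof. by move=> h; elim: k => //= k; exact: om_stable. Qed.

Lemma mult_iter_omD s k c d : s != rho ->
  mult s (iter k om (c + d)) =
  (mult s (iter k om c) + mult s (iter k om d))%N.
Proof. by move=> hs; rewrite iter_omD // multD. Qed.

Lemma mult_iter_om_sum s k (l : seq (mclasses R)) : s != rho ->
  mult s (iter k om (\sum_(x <- l) x)) = (\sum_(x <- l) mult s (iter k om x))%N.
Proof.
move=> hs; elim: l => [|x l IH]; first by rewrite !big_nil iter_om0 mult0.
by rewrite !big_cons mult_iter_omD // IH.
Qed.

(** Stably, a module and its quotient by a projective submodule have the same
    syzygy. *)
Lemma om_quotient_projective (P M M' : fgmod R) (i : {linear P -> M})
    (p : {linear M -> M'}) :
  projective P -> short_exact i p -> om (mclass M) =st= om (mclass M').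
Proof.
move=> pP ex; have [m [j [q0 ex0]]] := om_ses (mclass M').
have [j' [q ex']] := ses_transport ex0 (isomorphic_refl _) (crep_iso M').
have [r rE] := @projective_rV R m _ _ p q (ses_surj ex).
pose F := FGMod (fg_rV R m); pose K := crep (om (mclass M')).
have [h hE] := ses_lift_ker ex (g := (\- (r \o j')) : {linear K -> M})
  (fun x => ltac:(by rewrite linearN /= rE (ses_comp ex') oppr0)).
have exK : short_exact (pair_lin h j') (copair_lin i r).
  apply: short_exactI.
  - by move=> x y /= [_ /(ses_inj ex')].
  - by move=> x; rewrite /= hE /= addNr.
  - move=> [x y] /= e.
    have [z zE] : exists z, j' z = y.
      apply: (ses_ker ex'); rewrite -rE; have := congr1 p e.
      by rewrite linearD /= (ses_comp ex) add0r raddf0.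
    exists z; rewrite -zE; congr pair; apply: (ses_inj ex); rewrite hE /=.
    by apply/esym/eqP; rewrite -addr_eq0 zE e.
  - move=> y; have [f fE] := ses_surj ex' (p y).
    have [x xE] : exists x, i x = y - r f.
      by apply: (ses_ker ex); rewrite linearB /= rE fE subrr.
    by exists (x, f); rewrite /= xE subrK.
have := @om_stable_unique K (fgmod_dsum P F) M _ _
  (projective_prod pP (@projective_rV R m)) exK.
by rewrite crepK.
Qed.

Lemma nth_syzygy_rep n (M : fgmod R) :
  nth_syzygy n M (crep (iter n om (mclass M))).
Proof.
elim: n => [|n IH] /=; first exact/isomorphic_sym/crep_iso.
by exists (crep (iter n om (mclass M))); split=> //; exact: om_syzygy.
Qed.

Lemma nth_syzygy_class n (M : fgmod R) (N : lmodType R) :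
  nth_syzygy n M N ->
  exists fN : finitely_generated N, mclass (FGMod fN) = iter n om (mclass M).
Proof.
elim: n N => [|n IH] N /= => [e|[L [/IH[fL eL] sN]]].
  by exists (isomorphic_fg e (fgmodP M)); exact/esym/mclassP.
exists (syzygy_fg sN); rewrite -eL.
exact: (@syzygy_class (FGMod fL) (FGMod (syzygy_fg sN))).
Qed.

(** A module is periodic when its class returns to itself under [om]. *)
Lemma periodic_class (M : fgmod R) :
  periodic M <-> exists2 n, (0 < n)%N & iter n om (mclass M) = mclass M.
Proof.
split=> [[n [n0 [N [/nth_syzygy_class[fN e] eMN]]]]|[n n0 e]].
  by exists n => //; rewrite -e; apply/esym/mclassP.
exists n; split=> //; exists (crep (iter n om (mclass M))); split.
  exact: nth_syzygy_rep.
by rewrite e; exact/isomorphic_sym/crep_iso.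
Qed.

End Syzygies.

(** * Vanishing of Ext *)

Section ExtVanishing.
Variable R : comNzRingType.
Implicit Types K L M N P E : lmodType R.

(** The vanishing of Ext^1(M, ker d), stated as an extension property for
    linear maps into the kernel of [d]. *)
Definition ext_ker_vanishes E E' (d : {linear E -> E'}) M : Prop :=
  forall K P (i : {linear K -> P}) (p : {linear P -> M}), short_exact i p ->
  forall g : {linear K -> E}, (forall x, d (g x) = 0) ->
  exists2 h : {linear P -> E}, (forall x, d (h x) = 0) &
    forall x, h (i x) = g x.

(** The vanishing of Ext^1(M, R). *)
Definition ext_vanishes M : Prop :=
  forall K P (i : {linear K -> P}) (p : {linear P -> M}), short_exact i p ->
  forall g : {linear K -> (R^o : lmodType R)},
  exists h : {linear P -> (R^o : lmodType R)}, forall x, h (i x) = g x.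

(** Dimension shifting: if Ext^1(M, ker d') vanishes and [d] maps an injective
    module onto ker d', then Ext^1(K, ker d) vanishes for the syzygies K of M. *)
Lemma ext_ker_shift E E' E'' (d : {linear E -> E'}) (d' : {linear E' -> E''})
    K m M (i : {linear K -> 'rV[R]_m}) (p : {linear 'rV[R]_m -> M}) :
  injective_module E -> range d = d' @^-1` [set 0] -> short_exact i p ->
  ext_ker_vanishes d' M -> ext_ker_vanishes d K.
Proof.
move=> injE dd' ex van L P a b exP g dg.
have d'0 y : d' y = 0 -> exists x, d x = y.
  move=> y0; have : (d' @^-1` [set 0]) y by [].
  by rewrite -dd' => -[x _ <-]; exists x.
have dd'0 x : d' (d x) = 0.
  suff : (d' @^-1` [set 0]) (d x) by []. by rewrite -dd'; exists x.
have [h hE] := injE _ _ a g (ses_inj exP).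
have [k kE] := ses_factor_coker exP (g := (d \o h) : {linear _ -> _})
  (fun x => ltac:(by rewrite /= hE dg)).
have k0 x : d' (k x) = 0.
  by have [y <-] := ses_surj exP x; rewrite kE /= dd'0.
have [k' k'0 k'E] := van _ _ _ _ ex k k0.
(* h extends g but d h need not vanish; d h factors through K as k, and k
   lifts along d because it extends to the free module. *)
have [l lE] := rV_lift (fun j => d'0 _ (k'0 (delta_mx 0 j))).
exists (h \- (l \o (i \o b)) : {linear P -> E}) => x /=.
  by rewrite linearB /= lE k'E kE /= subrr.
by rewrite hE (ses_comp exP) !raddf0 addr0.
Qed.

Lemma ext_vanishes_iso M N : isomorphic M N -> ext_vanishes N -> ext_vanishes M.
Proof.
move=> e van K P i p ex g.
have [f [f' fK f'K]] := e.
have ex' : short_exact i (f \o p : {linear _ -> _}).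
  apply: short_exactI.
  - exact: ses_inj ex.
  - by move=> x /=; rewrite (ses_comp ex) raddf0.
  - move=> y /= e0; apply: (ses_ker ex); apply: (can_inj fK).
    by rewrite e0 raddf0.
  - by move=> y; have [x xE] := ses_surj ex (f' y); exists x; rewrite /= xE f'K.
exact: van ex' g.
Qed.

Lemma ext_vanishes_summand M N : ext_vanishes (M * N)%type -> ext_vanishes M.
Proof.
move=> van K P i p ex g.
have ex' : short_exact (@inl_lin _ P N \o i : {linear _ -> _})
    (prod_lin p (idfun : {linear N -> N})).
  apply: short_exactI.
  - by move=> x y /= [] /(ses_inj ex).
  - by move=> x /=; rewrite (ses_comp ex).
  - by move=> [x y] /= [] /(ses_ker ex)[z <-] ->; exists z.
  - by move=> [x y]; have [z <-] := ses_surj ex x; exists (z, y).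
have [h hE] := van _ _ _ _ ex' g.
by exists (h \o @inl_lin _ P N : {linear _ -> _}) => x; rewrite -hE.
Qed.

Lemma ext_vanishes_add_projective M N :
  projective N -> ext_vanishes M -> ext_vanishes (M * N)%type.
Proof.
move=> pN van K P i p ex g.
(* Q is the preimage of M, and P is the direct sum of Q and the image of s. *)
have q2s : surjective_fun (snd \o p : {linear P -> N}).
  by move=> y; have [x xE] := ses_surj ex (0, y); exists x; rewrite /= xE.
have [s sE] := pN _ _ p (@inr_lin _ M N) (ses_surj ex).
have [Q [j exQ]] := exists_kernel q2s.
have [u uE] := ses_lift_ker exQ (g := i) (fun x => ltac:(by rewrite /= (ses_comp ex))).
have exM : short_exact u (fst \o (p \o j) : {linear Q -> M}).
  apply: short_exactI.
  - by move=> x y e; apply: (ses_inj ex); rewrite -!uE e.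
  - by move=> x /=; rewrite uE (ses_comp ex).
  - move=> y /= e; have e2 := ses_comp exQ y.
    have [x xE] : exists x, i x = j y.
      by apply: (ses_ker ex); rewrite [LHS]surjective_pairing e (e2 : (p (j y)).2 = 0).
    by exists x; apply: (ses_inj exQ); rewrite uE.
  - move=> y; have [x xE] := ses_surj ex (y, 0).
    have [z zE] : exists z, j z = x by apply: (ses_ker exQ); rewrite /= xE.
    by exists z; rewrite /= zE xE.
have [h hE] := van _ _ _ _ exM g.
have [r rE] := ses_lift_ker exQ
  (g := (idfun \- (s \o (snd \o p))) : {linear P -> P})
  (fun x => ltac:(by rewrite /= linearB /= sE subrr)).
exists (h \o r : {linear _ -> _}) => x /=; rewrite -hE; congr (h _).
by apply: (ses_inj exQ); rewrite rE uE /= (ses_comp ex) !raddf0 addr0.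
Qed.

(** If Ext^1(M, R) vanishes, then maps into free modules extend as well. *)
Lemma ext_vanishes_rV K P M n (i : {linear K -> P}) (p : {linear P -> M})
    (g : {linear K -> 'rV[R]_n}) :
  ext_vanishes M -> short_exact i p ->
  exists h : {linear P -> 'rV[R]_n}, forall x, h (i x) = g x.
Proof.
move=> van ex.
have cl k : linear (fun x : K => g x 0 k : R^o).
  by move=> a u v; rewrite linearP !mxE.
have hP k := van _ _ _ _ ex (mklin (cl k)).
pose h k := sval (cid (hP k)).
have hE k x : h k (i x) = g x 0 k := svalP (cid (hP k)) x.
have hl : linear (fun x => \row_k h k x).
  by move=> a u v; apply/rowP => k; rewrite !mxE linearP.
by exists (mklin hl) => x; apply/rowP => k; rewrite mxE hE.
Qed.

(** Every finitely generated module over a noetherian ring has a left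
    approximation by a free module, obtained from generators of the dual. *)
Lemma free_left_approximation M : noetherian R -> finitely_generated M ->
  exists a (f : {linear M -> 'rV[R]_a}), forall n (g : {linear M -> 'rV[R]_n}),
    exists h : {linear 'rV[R]_a -> 'rV[R]_n}, forall x, h (f x) = g x.
Proof.
move=> noethR fgM; have [a [f fP]] := noetherian_dual_fg noethR fgM.
have fl : linear (fun x => \row_k f k x : 'rV[R]_a).
  by move=> b u v; apply/rowP => k; rewrite !mxE linearP.
exists a, (mklin fl) => n g.
have cl k : linear (fun x : M => g x 0 k : R^o).
  by move=> b u v; rewrite linearP !mxE.
have hP k := fP (mklin (cl k)).
pose h k := sval (cid (hP k)).
have hE k x : g x 0 k = \sum_j h k j * f j x := svalP (cid (hP k)) x.
exists (lincomb (fun j => \row_k h k j)) => x; apply/rowP => k.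
rewrite hE summxE; apply: eq_bigr => j _.
by rewrite !mxE mulrC.
Qed.

End ExtVanishing.

(** * Syzygies of maximal Cohen-Macaulay modules *)

Section CohenMacaulay.
Variable R : comNzRingType.
Hypothesis noethR : noetherian R.
Hypothesis locR : local_ring R.
Hypothesis krsR : krull_remak_schmidt R.
Implicit Types c d s : mclasses R.

Local Notation mult := (mult locR).
Local Notation rho := (rho R).
Local Notation om := (om noethR).
Local Notation "c =st= d" := (stable_eq locR c d) (at level 70).

(** The class of a module all of whose syzygies M satisfy Ext^1(M, R) = 0; over
    a Gorenstein local ring these are the maximal Cohen-Macaulay modules. *)
Definition mcm c : Prop := forall k, ext_vanishes (crep (iter k om c)).

(** Induction along an injective resolution E of R: if C_j is the kernel of
    [d j], then Ext^1(M, C_(n - j)) = 0 for every j-th syzygy M. *)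
Lemma gorenstein_mcm :
  finite_injective_dimension (R^o : lmodType R) ->
  exists n, forall c, mcm (iter n om c).
Proof.
move=> [n [E [e [d [injE zE inje rE rd]]]]].
have van j : (j <= n)%N ->
    forall c, ext_ker_vanishes (d (n - j)%N) (crep (iter j om c)).
  elim: j => [_ c|j IH jn c].
    move=> K P i p ex g _; rewrite subn0 in g *.
    have [h hE] := injE n _ _ i g (ses_inj ex).
    by exists h => // x; apply: (zE n.+1).
  have [m [i [p ex]]] := om_ses noethR (iter j om c).
  have := IH (ltnW jn) c; have -> : (n - j = (n - j.+1).+1)%N by lia.
  exact: (ext_ker_shift (injE _) (rd _) ex).
have vanR c : ext_vanishes (crep (iter n om c)).
  have := van n (leqnn n) c; rewrite subnn => {}van K P i p ex g.
  have e0 x : d 0%N (e x) = 0.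
    suff : (d 0%N @^-1` [set 0]) (e x) by []. by rewrite -rE; exists x.
  have [h h0 hE] := van _ _ _ _ ex (e \o g : {linear _ -> _}) (fun x => e0 (g x)).
  have hP x : exists y, e y = h x.
    have : (d 0%N @^-1` [set 0]) (h x) by exact: h0.
    by rewrite -rE => -[y _ <-]; exists y.
  pose l x := sval (cid (hP x)).
  have el x : e (l x) = h x := svalP (cid (hP x)).
  have ll : linear l by move=> a u v; apply: inje; rewrite linearP !el linearP.
  by exists (mklin ll) => x; apply: inje; rewrite /= el hE.
by exists n => c k; rewrite -iterD addnC iterD.
Qed.

Lemma ext_vanishes_stable c d :
  c =st= d -> ext_vanishes (crep c) -> ext_vanishes (crep d).
Proof.
move=> /(stable_add_free krsR) e van.
apply: (@ext_vanishes_summand _ _ (crep (rho *+ mult rho c))).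
apply: (ext_vanishes_iso (isomorphic_sym (crepD _ _))); rewrite -e.
apply: (ext_vanishes_iso (crepD _ _)).
rewrite -(class_rV (fg_rV R (mult rho d))).
apply: (@ext_vanishes_iso _ _ (crep c * 'rV[R]_(mult rho d))%type).
  by apply: isomorphic_prod; [exact: isomorphic_refl | exact: crep_iso].
by apply: ext_vanishes_add_projective => //; exact: projective_rV.
Qed.

Lemma mcm_summand c d : mcm (c + d) -> mcm c.
Proof.
move=> h k; apply: (@ext_vanishes_summand _ _ (crep (iter k om d))).
apply: (ext_vanishes_iso (isomorphic_sym (crepD _ _))).
exact: ext_vanishes_stable (iter_omD noethR locR krsR k c d) (h k).
Qed.

Lemma mcm_om c : mcm c -> mcm (om c).
Proof. by move=> h k; rewrite -iterSr. Qed.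

(** A decomposition of the syzygy of a module with vanishing Ext^1(-, R) comes
    from a stable decomposition of the module. *)
Lemma om_decomposition c a b :
  ext_vanishes (crep c) -> om c = a + b ->
  exists a' b' k l,
    [/\ c + rho *+ k = a' + b' + rho *+ l, om a' =st= a & om b' =st= b].
Proof.
move=> van e; have [m [j [p ex0]]] := om_ses noethR c.
have eab : isomorphic (crep (om c)) (crep a * crep b)%type.
  by rewrite e; exact: crepD.
have [i [q ex]] := ses_transport ex0 eab (isomorphic_refl _).
(* The embedding i of the modules in a and b into the free cover, and the sum
   ka of left approximations of these two modules, extend along each other. *)
have [x [f fP]] := free_left_approximation noethR (fgmodP (crep a)).
have [y [g gP]] := free_left_approximation noethR (fgmodP (crep b)).
have [h1 h1E] := fP _ (i \o @inl_lin _ (crep a) (crep b) : {linear _ -> _}).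
have [h2 h2E] := gP _ (i \o @inr_lin _ (crep a) (crep b) : {linear _ -> _}).
pose psi := copair_lin h1 h2; pose ka := prod_lin f g.
have psiE z : psi (ka z) = i z.
  case: z => u v; rewrite /= h1E h2E /= -linearD; congr (i _).
  by congr pair; rewrite /= ?addr0 ?add0r.
have [k1 k1E] := ext_vanishes_rV (f \o fst : {linear _ -> _}) van ex.
have [k2 k2E] := ext_vanishes_rV (g \o snd : {linear _ -> _}) van ex.
have phiE z : pair_lin k1 k2 (i z) = ka z by rewrite /= k1E k2E.
have ika : injective ka.
  by move=> u v ekuv; apply: (ses_inj ex); rewrite -!psiE ekuv.
have injf : injective f.
  move=> u v euv; have := ika (u, 0) (v, 0); rewrite /= euv.
  by move=> /(_ erefl) [].
have injg : injective g.
  move=> u v euv; have := ika (0, u) (0, v); rewrite /= euv.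
  by move=> /(_ erefl) [].
have [A [pf exf]] := exists_cokernel injf; have [B [pg exg]] := exists_cokernel injg.
have fgA := surjective_fg (ses_surj exf) (fg_rV R x).
have fgB := surjective_fg (ses_surj exg) (fg_rV R y).
pose F n := FGMod (fg_rV R n).
have /mclassP eM : isomorphic (fgmod_dsum (crep c) (fgmod_dsum (F x) (F y)))
    (fgmod_dsum (fgmod_dsum (FGMod fgA) (FGMod fgB)) (F m)).
  exact: schanuel_dual ex (short_exact_prod exf exg) phiE psiE.
rewrite !mclassD !class_rV !crepK -mulrnDr in eM.
exists (mclass (FGMod fgA)), (mclass (FGMod fgB)), (x + y)%N, m; split=> //.
  have := @om_stable_unique _ noethR _ krsR (crep a) (F x) (FGMod fgA) f pf.
  by rewrite crepK; apply; [exact: projective_rV | exact: exf].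
have := @om_stable_unique _ noethR _ krsR (crep b) (F y) (FGMod fgB) g pg.
by rewrite crepK; apply; [exact: projective_rV | exact: exg].
Qed.

(** The syzygy of a non-free indecomposable module with vanishing Ext^1(-, R)
    is stably indecomposable or zero. *)
Lemma om_atom_decomposition s a b :
  atom s -> s != rho -> ext_vanishes (crep s) -> om s = a + b ->
  a =st= 0 \/ b =st= 0.
Proof.
move=> sa sr van e; have [a' [b' [k [l [e' ha hb]]]]] := om_decomposition van e.
have multE x : x != rho -> (mult x a' + mult x b' = (s == x))%N.
  move=> xr; have := congr1 (mult x) e'.
  rewrite !multD // !multMn // (mult_atom _ krsR _ (atom_rho locR)).
  by rewrite [rho == x]eq_sym (negPf xr) (mult_atom _ krsR _ sa) !mul0n !addn0.
have omz x x' : om x' =st= x -> x' =st= 0 -> x =st= 0.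
  move=> h h'; apply: stable_trans (stable_sym h) _.
  by have := om_stable noethR krsR h'; rewrite om0.
have := multE s sr; rewrite eqxx.
case sa' : (mult s a') => [|n] sb'; [left; apply: omz ha _ | right; apply: omz hb _].
  move=> x xr; rewrite mult0 //; have := multE x xr.
  by have [<-|_] := eqVneq s x; [rewrite sa' | lia].
move=> x xr; rewrite mult0 //; have := multE x xr.
by have [<-|_] := eqVneq s x; lia.
Qed.

(** The minimal syzygy of a module with vanishing Ext^1(-, R) has no free
    summand: a projection onto R would extend to the free cover, but the syzygy
    has no invertible coordinate there. *)
Lemma om_no_free_summand c : ext_vanishes (crep c) -> mult rho (om c) = 0%N.
Proof.
move=> van; apply/eqP; rewrite -leqn0 leqNgt; apply/negP.
case/mult_summand => _ [d e].
have [m [mc [i [p ex]]]] := om_syzygy noethR c.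
have iso : isomorphic (crep (om c)) ((R^o : lmodType R) * crep d)%type.
  rewrite e; apply: isomorphic_trans (crepD _ _) _.
  by apply: isomorphic_prod; [exact: crep_iso | exact: isomorphic_refl].
have [f [g fK gK]] := iso.
have [h hE] := van _ _ _ _ ex (fst \o f : {linear _ -> _}).
pose x := i (g (1, 0)).
have hx : h x = 1 by rewrite hE /= gK.
have gen y : exists b : 'I_m -> R, y = \sum_(j < m) b j *: p (delta_mx 0 j).
  have [z <-] := ses_surj ex y; exists (fun j => z 0 j); exact: linear_rV.
have nx : forall j, ~ invertible (x 0 j).
  apply: (min_generators_relation mc gen).
  by rewrite -linear_rV /x (ses_comp ex).
apply: (nonunit_sum locR (c := fun j => h (delta_mx 0 j)) nx).
have <- : h x = \sum_j h (delta_mx 0 j) * x 0 j.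
  by rewrite linear_rV; apply: eq_bigr => j _; rewrite mulrC.
by rewrite hx; exact: invertible1.
Qed.

(** Classes of non-free indecomposable maximal Cohen-Macaulay modules. *)
Definition mcm_atom s : Prop := [/\ atom s, s != rho & mcm s].

Lemma om_mcm_atom s : mcm_atom s -> om s = 0 \/ mcm_atom (om s).
Proof.
move=> [sa sr hs]; have [->|om_n0] := eqVneq (om s) 0; [by left | right].
have nofree := om_no_free_summand (hs 0%N).
have [x xa xm] := atom_mult locR om_n0.
have xr : x != rho by apply: contraTneq xm => ->; rewrite nofree.
have [_ [d e]] := mult_summand xm.
have [/(_ x xr)|d0] := om_atom_decomposition sa sr (hs 0%N) e.
  by rewrite mult0 // (mult_atom _ krsR _ xa) eqxx.
have dz : d = 0.
  rewrite (stable0_free krsR d0); have := congr1 (mult rho) e.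
  rewrite nofree multD // => /esym/eqP; rewrite addn_eq0 => /andP[_ /eqP ->].
  by rewrite mulr0n.
have -> : om s = x by rewrite e dz addr0.
split=> //; have := mcm_om hs; rewrite e dz addr0; exact.
Qed.

Lemma iter_om_mcm_atom k s :
  mcm_atom s -> iter k om s = 0 \/ mcm_atom (iter k om s).
Proof.
move=> hs; elim: k => [|k [IH|IH]] /=; [by right | | exact: om_mcm_atom].
by left; rewrite IH om0.
Qed.

Lemma mult_iter_mcm_atom s k x : mcm_atom s -> mcm_atom x ->
  mult x (iter k om s) = (iter k om s == x) :> nat.
Proof.
move=> hs hx; have [->|[ka _ _]] := iter_om_mcm_atom k hs.
  by rewrite mult0 //; case: hx => -[/negPf + _] _ _; rewrite eq_sym => ->.
exact: mult_atom.
Qed.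

End CohenMacaulay.

(** * Laurent polynomials *)

Section Laurent.
Implicit Types (p q : {poly int}) (r : laurent) (g : int -> int).

(** The pairing of the Laurent polynomial p / t^n with a function on the
    exponents. *)
Definition poly_pair p n g : int := \sum_(i < size p) p`_i * g (i%:Z - n%:Z).

(** The bound on the exponents can be enlarged. *)
Lemma poly_pairE m p n g : (size p <= m)%N ->
  poly_pair p n g = \sum_(i < m) p`_i * g (i%:Z - n%:Z).
Proof.
move=> pm; rewrite /poly_pair -!(big_mkord xpredT (fun i => p`_i * g (i%:Z - n%:Z))).
rewrite (big_cat_nat (leq0n _) pm) /= [X in _ = _ + X]big_nat
  [X in _ = _ + X]big1 ?addr0 //.
by move=> i /andP[hi _]; rewrite nth_default ?mul0r.
Qed.

Lemma poly_pairD p q n g :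
  poly_pair (p + q) n g = poly_pair p n g + poly_pair q n g.
Proof.
pose m := maxn (size p) (size q).
rewrite !(@poly_pairE m) ?leq_maxl ?leq_maxr ?size_polyD //.
by rewrite -big_split; apply: eq_bigr => i _; rewrite coefD mulrDl.
Qed.

Lemma poly_pairMXn p k n g :
  poly_pair (p * 'X^k) n g = poly_pair p n (fun j => g (j + k%:Z)).
Proof.
rewrite (@poly_pairE (k + size p)); last first.
  have [->|p0] := eqVneq p 0; first by rewrite mul0r size_poly0.
  by rewrite size_mulXn // addnC.
rewrite big_split_ord /= big1 => [|i _]; last by rewrite coefMXn ltn_ord mul0r.
rewrite add0r; apply: eq_bigr => i _; rewrite coefMXn ltnNge leq_addr /= addKn.
by congr (_ * g _); rewrite PoszD; ring.
Qed.

Lemma poly_pair_denom p k n g :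
  poly_pair (p * 'X^k) (n + k) g = poly_pair p n g.
Proof.
rewrite poly_pairMXn; apply: eq_bigr => i _; congr (_ * g _).
by rewrite PoszD; ring.
Qed.

Lemma tofrac_Xn_neq0 n : tofrac ('X^n : {poly int}) != 0.
Proof. by rewrite tofrac_eq0 monic_neq0 // monicXn. Qed.

Lemma laurent_fraction r :
  exists pn : {poly int} * nat, laurent_val r = tofrac pn.1 / tofrac 'X^(pn.2).
Proof. by have /asboolP[p [n e]] := laurentP r; exists (p, n). Qed.

(** The pairing of a Laurent polynomial with a function on the exponents, which
    does not depend on the chosen fraction by [laurent_pairE]. *)
Definition laurent_pair r g : int :=
  let pn := sval (cid (laurent_fraction r)) in poly_pair pn.1 pn.2 g.

Lemma laurent_pairE r p n g :
  laurent_val r = tofrac p / tofrac 'X^n -> laurent_pair r g = poly_pair p n g.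
Proof.
rewrite /laurent_pair; case: cid => -[q m] /= -> /eqP.
rewrite eqr_div ?tofrac_Xn_neq0 // -!tofracM tofrac_eq => /eqP e.
by rewrite -(poly_pair_denom q n m g) e addnC poly_pair_denom.
Qed.

Lemma eq_laurent_pair r g g' : g =1 g' -> laurent_pair r g = laurent_pair r g'.
Proof. by move=> h; apply: eq_bigr => i _; rewrite h. Qed.

Lemma laurent_pairD r s g :
  laurent_pair (r + s) g = laurent_pair r g + laurent_pair s g.
Proof.
have [[p n] /= rE] := laurent_fraction r; have [[q m] /= sE] := laurent_fraction s.
rewrite (laurent_pairE g rE) (laurent_pairE g sE).
rewrite (@laurent_pairE _ (p * 'X^m + q * 'X^n) (n + m)).
  by rewrite poly_pairD poly_pair_denom addnC poly_pair_denom.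
rewrite -[laurent_val (r + s)]/(laurent_val r + laurent_val s) rE sE.
by rewrite addf_div ?tofrac_Xn_neq0 // exprD tofracD !tofracM.
Qed.

Lemma laurent_pair0 g : laurent_pair 0 g = 0.
Proof.
by apply: (addrI (laurent_pair 0 g)); rewrite -laurent_pairD !addr0.
Qed.

Lemma laurent_pair1 g : laurent_pair 1 g = g 0.
Proof.
rewrite (@laurent_pairE _ 1 0); last by rewrite expr0 tofrac1 divr1.
by rewrite /poly_pair size_poly1 big_ord1 coef1 mul1r subrr.
Qed.

Lemma laurent_pair_t r g :
  laurent_pair (laurent_t * r) g = laurent_pair r (fun j => g (j + 1)).
Proof.
have [[p n] /= rE] := laurent_fraction r.
rewrite (laurent_pairE _ rE) (@laurent_pairE _ (p * 'X^1) n).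
  by rewrite poly_pairMXn.
rewrite -[laurent_val (_ * r)]/(laurent_val laurent_t * laurent_val r) rE.
by rewrite expr1 tofracM mulrA [tofrac p * _]mulrC.
Qed.

(** A polynomial in t as a Laurent polynomial. *)
Definition poly_laurent p : laurent := \sum_(i < size p) laurent_t ^+ i *~ p`_i.

Lemma laurent_val_tX n : laurent_val (laurent_t ^+ n) = tofrac 'X^n.
Proof.
elim: n => [|n IH]; first by rewrite !expr0 tofrac1.
by rewrite !exprS tofracM -IH.
Qed.

Lemma laurent_val_poly p : laurent_val (poly_laurent p) = tofrac p.
Proof.
rewrite -[in RHS](coefK p) poly_def [RHS]rmorph_sum.
rewrite [LHS](raddf_sum (val : {additive laurent -> _})); apply: eq_bigr => i _.
rewrite [LHS](raddfMz (val : {additive laurent -> _})) /= laurent_val_tX.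
by rewrite -[in RHS](intz p`_i) scaler_int rmorphMz.
Qed.

Lemma laurent_t_unit : exists t', t' * laurent_t = 1.
Proof.
have h : (tofrac ('X : {poly int}))^-1 \in laurent_pred.
  by apply/asboolP; exists 1, 1%N; rewrite tofrac1 mul1r.
exists (Laurent h); apply: val_inj => /=; apply: mulVf.
by have := tofrac_Xn_neq0 1.
Qed.

Lemma laurent_tX_eq0 (V : lmodType laurent) n (v : V) :
  laurent_t ^+ n *: v = 0 -> v = 0.
Proof.
have [t' e] := laurent_t_unit => h.
by rewrite -[v]scale1r -(expr1n _ n) -e exprMn -scalerA h scaler0.
Qed.

(** Every Laurent polynomial is a polynomial in t up to a power of t. *)
Lemma laurent_tX_poly r :
  exists n p, laurent_t ^+ n * r = poly_laurent p /\ (r != 0 -> p != 0).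
Proof.
have [[p n] /= rE] := laurent_fraction r; exists n, p; split.
  apply: val_inj; rewrite [RHS]laurent_val_poly rmorphM rmorphXn /=.
  rewrite -[X in _ * X]/(laurent_val r) rE -[X in X ^+ _]/(tofrac 'X).
  by rewrite -tofracXn mulrC divfK ?tofrac_Xn_neq0.
apply: contra_neq => p0; apply: val_inj; rewrite -[LHS]/(laurent_val r) rE p0.
by rewrite tofrac0 mul0r.
Qed.

Lemma laurent_tX_neq1 n : (0 < n)%N -> 1 - laurent_t ^+ n != 0.
Proof.
move=> n0; apply/eqP => /(congr1 val); rewrite rmorphB rmorph1 rmorphXn /=.
rewrite -[X in X ^+ _]/(tofrac 'X) -tofracXn -tofrac1 -tofracB.
move/eqP; rewrite tofrac_eq0 subr_eq0 => /eqP /(congr1 (fun p => p`_0)).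
by rewrite coef1 coefXn /= eq_sym (gtn_eqF n0) => /eqP; rewrite oner_eq0.
Qed.

End Laurent.

(** * The invariants of J *)

Lemma PoszS_sub1 (n : nat) : n.+1%:Z - 1 = n%:Z.
Proof. by rewrite -addn1 PoszD addrK. Qed.

Section Evaluation.
Variables (R : comNzRingType) (h : mclasses R -> int -> int).
Implicit Types x y : Jfree R.

(** The convolution of an element of the free module with a family of
    functions on the exponents: [t ^+ k *: << c >>] is sent to the function
    [fun N => h c (N - k)]. *)
Definition conv x (N : int) : int :=
  \sum_(c <- msupp x) laurent_pair x@_c (fun k => h c (N - k)).

Lemma convE (D : {fset mclasses R}) x N : (msupp x `<=` D)%fset ->
  conv x N = \sum_(c <- D) laurent_pair x@_c (fun k => h c (N - k)).
Proof.
move=> xD; apply: big_fset_incl => // c _ /mcoeff_outdom ->.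
exact: laurent_pair0.
Qed.

Lemma convD x y N : conv (x + y) N = conv x N + conv y N.
Proof.
rewrite !(@convE (msupp x `|` msupp y)%fset) ?fsubsetUl ?fsubsetUr ?msuppD_le //.
by rewrite -big_split; apply: eq_bigr => c _; rewrite mcoeffD laurent_pairD.
Qed.

Lemma conv0 N : conv 0 N = 0.
Proof. by apply: (addrI (conv 0 N)); rewrite -convD !addr0. Qed.

Lemma convN x N : conv (- x) N = - conv x N.
Proof. by apply: (addrI (conv x N)); rewrite -convD !subrr conv0. Qed.

Lemma convMz x z N : conv (x *~ z) N = conv x N * z.
Proof.
have n0 n : conv (x *+ n) N = conv x N * n%:Z.
  elim: n => [|n IH]; first by rewrite mulr0n conv0 mulr0.
  by rewrite mulrS convD IH intS mulrDr mulr1.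
case: z => n; first by rewrite -n0.
by rewrite NegzE mulrNz convN -[x *~ _]/(x *+ n.+1) n0 mulrN.
Qed.

Lemma conv_t x N : conv (laurent_t *: x) N = conv x (N - 1).
Proof.
rewrite (@convE (msupp x)) ?msuppZ_le //; apply: eq_bigr => c _.
rewrite mcoeffZ laurent_pair_t; apply: eq_laurent_pair => k; congr (h c _).
by ring.
Qed.

Lemma conv_basis c N : conv << c >> N = h c N.
Proof.
rewrite (@convE [fset c]%fset); last first.
  apply/fsubsetP => d; rewrite -mcoeff_neq0 mcoeffU inE.
  by case: (eqVneq c d) => // _; rewrite mulr0n eqxx.
by rewrite big_seq_fset1 mcoeffU eqxx mulr1n laurent_pair1 subr0.
Qed.

End Evaluation.

Section Jmodule.
Variable R : comNzRingType.
Hypothesis noethR : noetherian R.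
Hypothesis locR : local_ring R.
Hypothesis krsR : krull_remak_schmidt R.
Implicit Types c d s : mclasses R.

Local Notation mult := (mult locR).
Local Notation rho := (rho R).
Local Notation om := (om noethR).
Local Notation "c =st= d" := (stable_eq locR c d) (at level 70).
Local Notation t := laurent_t.

(** The multiplicity of [s] in the [j]-th syzygy of a module; the value 0 at
    negative [j] plays no role, since only large [j] matter. *)
Definition syz_mult s c (j : int) : int :=
  if j is Posz k then (mult s (iter k om c))%:Z else 0.

(** The elements of the free module whose multiplicities in the N-th syzygies
    vanish for all large N. *)
Definition eventually0 : set (Jfree R) := [set x | exists N0 : nat,
  forall N : nat, (N0 <= N)%N -> forall s, s != rho -> conv (syz_mult s) x N%:Z = 0].

Lemma eventually0D x y : eventually0 x -> eventually0 y -> eventually0 (x + y).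
Proof.
move=> [m hm] [n hn]; exists (maxn m n) => N; rewrite geq_max => /andP[mN nN] s hs.
by rewrite convD hm ?hn.
Qed.

Lemma eventually0Mz x z : eventually0 x -> eventually0 (x *~ z).
Proof. by move=> [m hm]; exists m => N mN s hs; rewrite convMz hm ?mul0r. Qed.

Lemma eventually0_0 : eventually0 0.
Proof. by exists 0%N => N _ s _; rewrite conv0. Qed.

Lemma eventually0_t x : eventually0 (t *: x) <-> eventually0 x.
Proof.
split=> -[m hm].
  exists m => N mN s hs; have := hm N.+1 (leqW mN) s hs; rewrite conv_t.
  by rewrite PoszS_sub1.
exists m.+1 => -[//|N] mN s hs; rewrite conv_t PoszS_sub1.
exact: hm.
Qed.

Lemma eventually0_tX n x : eventually0 (t ^+ n *: x) <-> eventually0 x.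
Proof.
elim: n => [|n IH]; first by rewrite expr0 scale1r.
by rewrite exprS -scalerA eventually0_t.
Qed.

Lemma eventually0_submodule : submodule eventually0.
Proof.
split=> [|a x y hx hy]; first exact: eventually0_0.
apply: eventually0D => //; have [n [p [e _]]] := laurent_tX_poly a.
apply/(eventually0_tX n); rewrite scalerA e /poly_laurent scaler_suml.
elim/big_ind: _ => [|u v|i _]; [exact: eventually0_0 | exact: eventually0D|].
have -> : (t ^+ i *~ p`_i) *: x = (t ^+ i *: x) *~ p`_i.
  by rewrite -mulrzl -scalerA scaler_int.
by apply: eventually0Mz; apply/eventually0_tX.
Qed.

Lemma Jrel_eventually0 x : Jrel x -> eventually0 x.
Proof.
have stable_mult c d s N : s != rho -> om c =st= om d ->
    mult s (iter N.+1 om c) = mult s (iter N.+1 om d).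
  by move=> hs h; rewrite !iterSr (iter_om_stable noethR krsR N h).
case=> [P M M' i p pP ex|M' P M i p pP ex|M M'].
- exists 1%N => -[//|N] _ s hs.
  rewrite convD convN !conv_basis /= -!iterS.
  have h := om_quotient_projective noethR locR krsR pP ex.
  by rewrite (stable_mult _ _ _ _ hs h) subrr.
- exists 1%N => -[//|N] _ s hs.
  rewrite convD convN conv_t !conv_basis PoszS_sub1 /= -iterS iterSr.
  have h := om_stable_unique noethR locR krsR pP ex.
  by rewrite (iter_om_stable noethR krsR N h) // subrr.
- exists 0%N => N _ s hs; rewrite !convD !convN !conv_basis mclassD /=.
  by rewrite mult_iter_omD // PoszD addrAC addrK subrr.
Qed.

(** The element of J defined by an isomorphism class. *)
Definition jcl c : J R := quot_proj (@Jrel R) (<< c >> : Jfree R).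

(** The eventual multiplicities are invariants of elements of J. *)
Lemma quot_proj_eventually0 (x : Jfree R) :
  quot_proj (@Jrel R) x = 0 -> eventually0 x.
Proof.
move/eqP; rewrite quot_proj_eq0 => /asboolP; apply.
  exact: eventually0_submodule.
exact: Jrel_eventually0.
Qed.

Lemma quot_proj_rel x : Jrel x -> quot_proj (@Jrel R) x = 0.
Proof.
move=> h; apply/eqP; rewrite quot_proj_eq0; apply/asboolP => S _; exact.
Qed.

Lemma jclD c d : jcl (c + d) = jcl c + jcl d.
Proof.
have := quot_proj_rel (Jrel3 (crep c) (crep d)).
rewrite !linearB /Jbasis mclassD !crepK -addrA -opprD => /eqP.
by rewrite subr_eq0 => /eqP.
Qed.

Lemma jcl0 : jcl 0 = 0.
Proof. by apply: (addrI (jcl 0)); rewrite -jclD !addr0. Qed.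

Lemma jcl_om c : jcl c = t *: jcl (om c).
Proof.
have [m [i [p ex]]] := om_ses noethR c.
have := quot_proj_rel (@Jrel2 R (crep (om c)) (FGMod (fg_rV R m)) (crep c) i p
  (@projective_rV R m) ex).
rewrite linearB linearZ /Jbasis !crepK => /eqP.
by rewrite subr_eq0 => /eqP.
Qed.

Lemma jcl_iter_om n c : jcl c = t ^+ n *: jcl (iter n om c).
Proof.
elim: n c => [|n IH] c; first by rewrite expr0 scale1r.
by rewrite exprSr -scalerA iterS -jcl_om -IH.
Qed.

Lemma jcl_free n : jcl (rho *+ n) = 0.
Proof. by rewrite jcl_om om_free // jcl0 scaler0. Qed.

Lemma jcl_stable c d : c =st= d -> jcl c = jcl d.
Proof.
move=> /(stable_add_free krsR) /(congr1 jcl); rewrite !jclD !jcl_free.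
by rewrite !addr0.
Qed.

(** Up to a power of t, every element of J is a difference of two classes. *)
Lemma J_difference (u : J R) :
  exists K X Y, u = t ^+ K *: (jcl X - jcl Y).
Proof.
pose D : set (J R) := [set u | exists K X Y, u = t ^+ K *: (jcl X - jcl Y)].
have D0 : D 0 by exists 0%N, 0, 0; rewrite subrr scaler0.
have DD v w : D v -> D w -> D (v + w).
  move=> [K [X [Y ->]]] [L [X' [Y' ->]]].
  exists (K + L)%N, (iter L om X + iter K om X'), (iter L om Y + iter K om Y').
  rewrite (jcl_iter_om L X) (jcl_iter_om L Y) (jcl_iter_om K X') (jcl_iter_om K Y').
  rewrite -!scalerBr !scalerA -!exprD [(L + K)%N]addnC -scalerDr !jclD.
  by congr (_ *: _); rewrite opprD addrACA.
have DN v : D v -> D (- v).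
  move=> [K [X [Y ->]]]; exists K, Y, X.
  by rewrite -scalerN opprB.
have DMz v z : D v -> D (v *~ z).
  move=> Dv; have DMn n : D (v *+ n).
    by elim: n => [|n IH]; rewrite ?mulr0n // mulrS; apply: DD.
  by case: z => n; [exact: DMn | rewrite NegzE mulrNz; exact/DN/DMn].
have DtX v n : D v -> D (t ^+ n *: v).
  by move=> [K [X [Y ->]]]; exists (n + K)%N, X, Y; rewrite scalerA exprD.
have DtXV v n : D (t ^+ n *: v) -> D v.
  move=> [K [X [Y e]]]; exists K, (iter n om X), (iter n om Y).
  apply/eqP; rewrite -subr_eq0; apply/eqP; apply: (@laurent_tX_eq0 _ n).
  rewrite scalerBr e (jcl_iter_om n X) (jcl_iter_om n Y) -scalerBr.
  by rewrite !scalerA mulrC subrr.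
have DZ a v : D v -> D (a *: v).
  move=> Dv; have [n [p [e _]]] := laurent_tX_poly a.
  apply: (DtXV _ n); rewrite scalerA e /poly_laurent scaler_suml.
  elim/big_ind: _ => // i _.
  have -> : (t ^+ i *~ p`_i) *: v = (t ^+ i *: v) *~ p`_i.
    by rewrite -mulrzl -scalerA scaler_int.
  exact/DMz/DtX.
have [x <-] := quot_proj_surj u; rewrite [x]monalgE linear_sum.
suff : D (\sum_(c <- msupp x) quot_proj (@Jrel R) << x@_c *g c >>) by [].
elim/big_ind: _ => // c _.
have -> : << x@_c *g c >> = x@_c *: (<< c >> : Jfree R).
  by apply/malgP => d; rewrite mcoeffZ !mcoeffU mulr_natr.
rewrite linearZ; apply: DZ; exists 0%N, c, 0.
by rewrite expr0 scale1r jcl0 subr0.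
Qed.

End Jmodule.

(** * Torsion and periodicity *)

Lemma seq_minimal (T : eqType) (lt : T -> T -> Prop) (l : seq T) :
  (forall x y z, lt x y -> lt y z -> lt x z) ->
  (forall x, x \in l -> ~ lt x x) -> l != [::] ->
  exists2 m, m \in l & forall x, x \in l -> ~ lt x m.
Proof.
move=> tr; elim: l => // x l IH irr _.
have [l0|ln] := eqVneq l [::].
  exists x => [|y]; first by rewrite mem_head.
  by rewrite l0 inE => /eqP ->; apply: irr; rewrite mem_head.
have [|//|m ml mP] := IH.
  by move=> y yl; apply: irr; rewrite inE yl orbT.
have [xm|xm] := pselect (lt x m); [exists x | exists m].
- by rewrite mem_head.
- move=> y; rewrite inE => /orP[/eqP ->|yl yx].
    by apply: irr; rewrite mem_head.
  exact: mP yl (tr _ _ _ yx xm).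
- by rewrite inE ml orbT.
- by move=> y; rewrite inE => /orP[/eqP -> //|/mP].
Qed.

Section Torsion.
Variable R : comNzRingType.
Hypothesis noethR : noetherian R.
Hypothesis locR : local_ring R.
Hypothesis krsR : krull_remak_schmidt R.
Implicit Types c d s X Y : mclasses R.

Local Notation mult := (mult locR).
Local Notation rho := (rho R).
Local Notation om := (om noethR).
Local Notation "c =st= d" := (stable_eq locR c d) (at level 70).
Local Notation t := laurent_t.

(** If the class vanished in J, then [c] would be free, and [om c] would be 0. *)
Lemma jcl_periodic_neq0 c n :
  (0 < n)%N -> iter n om c = c -> c != 0 -> jcl c != 0.
Proof.
move=> n0 e; apply: contra_neq => /(quot_proj_eventually0 noethR locR krsR).
have ek k : iter (k * n) om c = c.
  by elim: k => // k IH; rewrite mulSn iterD IH.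
case=> N0 hN; have c0 : c =st= 0.
  move=> s hs; have := hN (N0 * n)%N (leq_pmulr _ n0) s hs.
  by rewrite conv_basis /= ek mult0 // => -[].
rewrite -e -(prednK n0) iterSr (stable0_free krsR c0) om_free //.
exact: iter_om0.
Qed.

Lemma jcl_periodic_torsion c n :
  (0 < n)%N -> iter n om c = c -> torsion (jcl c).
Proof.
move=> n0 e; exists (1 - t ^+ n); split; first exact: laurent_tX_neq1.
by rewrite scalerBl scale1r {1}(jcl_iter_om noethR n c) e subrr.
Qed.

(** Let [X] and [Y] be stably different maximal Cohen-Macaulay classes, and
    suppose that no atom is periodic. Among the non-free atoms whose
    multiplicities in [X] and [Y] differ there is one that is not a higher
    syzygy of another; its multiplicities in the higher syzygies of [X] and [Y]
    then agree. *)
Lemma minimal_summand X Y :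
  mcm noethR X -> mcm noethR Y -> ~ (X =st= Y) ->
  (forall s n, atom s -> (0 < n)%N -> iter n om s <> s) ->
  exists s, [/\ s != rho, mult s X <> mult s Y & forall j, (0 < j)%N ->
    mult s (iter j om X) = mult s (iter j om Y)].
Proof.
move=> mX mY XY aper.
pose l := [seq s <- summands locR X ++ summands locR Y |
  (s != rho) && (mult s X != mult s Y)].
have in_summands s c : (0 < mult s c)%N -> s \in summands locR c.
  by rewrite -has_count has_pred1.
have lP s : s \in l <-> s != rho /\ mult s X <> mult s Y.
  rewrite mem_filter; split=> [/andP[/andP[sr /eqP//]] //|[sr /eqP sXY]].
  rewrite sr sXY mem_cat; apply/orP.
  case: (posnP (mult s X)) => [sX0|/in_summands]; [right | by left].
  by apply: in_summands; rewrite lt0n eq_sym -sX0.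
have latom s : s \in l -> mcm_atom noethR s.
  move=> sl; have [sr _] := (lP s).1 sl; move: sl; rewrite mem_filter mem_cat.
  have summand_mcm c : mcm noethR c -> s \in summands locR c -> mcm_atom noethR s.
    move=> mc sc; have [|sa [d e]] := @mult_summand _ locR s c.
      by rewrite -has_count has_pred1.
    by split=> //; apply: (mcm_summand locR krsR (d := d)); rewrite -e.
  by case/andP => _ /orP[]; exact: summand_mcm.
pose lt s' s := exists2 j, (0 < j)%N & iter j om s' = s.
have [|||s sl smin] := @seq_minimal _ lt l.
- move=> x y z [j j0 <-] [k k0 <-]; exists (k + j)%N; rewrite ?iterD //.
  by rewrite addn_gt0 k0.
- by move=> x xl [j j0]; have [xa _ _] := latom x xl; exact: aper xa j0.
- apply/eqP => l0; apply: XY => s sr; apply: contrapT => h.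
  by have /lP : s != rho /\ mult s X <> mult s Y by []; rewrite l0.
have [sr sXY] := (lP s).1 sl; exists s; split=> // j j0.
pose F x := mult s (iter j om x).
(* The summands that contribute to s after j steps have the same multiplicity
   in X and Y. *)
have FP x : F x != 0%N -> mult x X = mult x Y.
  move=> Fx; apply: contrapT => h.
  have xr : x != rho.
    apply: contra_neq Fx => ->; rewrite /F -(prednK j0) iterSr.
    by rewrite (om_free noethR locR krsR 1) iter_om0 // mult0.
  have xl : x \in l by apply/lP.
  apply: (smin x xl); exists j => //; apply/eqP; move: Fx; rewrite /F.
  rewrite (mult_iter_mcm_atom locR krsR j (latom x xl) (latom s sl)).
  by rewrite eqb0 negbK.
have FE c : mult s (iter j om c) =
    (\sum_(x <- [seq x <- summands locR c | F x != 0%N]) F x)%N.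
  rewrite {1}(summandsE locR c) (mult_iter_om_sum noethR locR krsR) //.
  rewrite big_filter [RHS]big_rmcond // => x.
  by rewrite negbK => /eqP.
rewrite !FE; apply: perm_big; apply/allP => x _ /=; apply/eqP.
rewrite !count_filter; case Fx : (F x != 0%N).
  have cE c :
      count (predI (pred1 x) (fun x => F x != 0%N)) (summands locR c) = mult x c.
    by apply: eq_count => y /=; case: eqP => // ->; rewrite Fx.
  by rewrite !cE FP.
have cE c : count (predI (pred1 x) (fun x => F x != 0%N)) (summands locR c) = 0%N.
  rewrite -[RHS](count_pred0 (summands locR c)).
  by apply: eq_count => y /=; case: eqP => // ->; rewrite Fx.
by rewrite !cE.
Qed.

Lemma J_torsion_periodic m (u : J R) :
  (forall c, mcm noethR (iter m om c)) -> u != 0 -> torsion u ->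
  exists s n, [/\ atom s, (0 < n)%N & iter n om s = s].
Proof.
move=> mcmP u0 [r [r0 ru]]; apply: contrapT => noper.
have [K [X0 [Y0 uE]]] := J_difference noethR u.
pose X := iter m om X0; pose Y := iter m om Y0.
pose w := jcl X - jcl Y.
have uw : u = t ^+ (K + m) *: w.
  rewrite uE (jcl_iter_om noethR m X0) (jcl_iter_om noethR m Y0).
  by rewrite -scalerBr scalerA -exprD.
have w0 : w != 0 by apply: contra_neq u0; rewrite uw => ->; rewrite scaler0.
have [n [p [rp /(_ r0) p0]]] := laurent_tX_poly r.
have pw : poly_laurent p *: w = 0.
  apply: (@laurent_tX_eq0 _ (K + m)).
  by rewrite scalerA mulrC -scalerA -uw -rp -scalerA ru scaler0.
pose x : Jfree R := << X >> - << Y >>.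
pose z := \sum_(i < size p) (t ^+ i *: x) *~ p`_i.
have z0 : eventually0 noethR locR z.
  apply: quot_proj_eventually0 => //.
  rewrite -[RHS]pw /poly_laurent scaler_suml linear_sum.
  apply: eq_bigr => i _; rewrite raddfMz /= linearZ linearB /=.
  by rewrite -[in RHS]mulrzl -scalerA scaler_int.
have [N0 hN] := z0; pose X' := iter N0 om X; pose Y' := iter N0 om Y.
have mX' : mcm noethR X' by rewrite /X' /X -iterD addnC iterD.
have mY' : mcm noethR Y' by rewrite /Y' /Y -iterD addnC iterD.
have XY' : ~ (X' =st= Y').
  move=> /(jcl_stable noethR krsR) e; case/eqP: w0.
  rewrite /w (jcl_iter_om noethR N0 X) (jcl_iter_om noethR N0 Y).
  by rewrite -/X' -/Y' e subrr.
have aper s i : atom s -> (0 < i)%N -> iter i om s <> s.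
  by move=> sa i0 e; apply: noper; exists s, i.
have [s [sr sXY sj]] := minimal_summand mX' mY' XY' aper.
have conv_tX i (v : Jfree R) N : conv (syz_mult noethR locR s) (t ^+ i *: v) N =
    conv (syz_mult noethR locR s) v (N - i%:Z).
  elim: i N => [|i IH] N; first by rewrite expr0 scale1r subr0.
  by rewrite exprS -scalerA conv_t IH intS opprD addrA.
have conv_x j : conv (syz_mult noethR locR s) x (N0 + j)%:Z =
    (mult s (iter j om X'))%:Z - (mult s (iter j om Y'))%:Z.
  by rewrite convD convN !conv_basis /= addnC !iterD.
have conv_sum (I : Type) (q : seq I) (f : I -> Jfree R) N :
    conv (syz_mult noethR locR s) (\sum_(i <- q) f i) N =
    \sum_(i <- q) conv (syz_mult noethR locR s) (f i) N.
  by elim: q => [|i q IH]; rewrite ?big_nil ?conv0 // !big_cons convD IH.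
pose D := (size p).-1; have sp : size p = D.+1 by rewrite prednK // size_poly_gt0.
have := hN (N0 + D)%N (leq_addr _ _) s sr.
(* In level N0 + D only the leading term involves the syzygies of X' and Y' of
   order 0; all others have positive order. *)
rewrite /z conv_sum sp big_ord_recr /= big1 => [|i _]; last first.
  rewrite convMz conv_tX PoszD -addrA subzn 1?ltnW // -PoszD conv_x.
  by rewrite sj ?subn_gt0 // subrr mul0r.
rewrite add0r convMz conv_tX PoszD addrK -[N0 in N0%:Z]addn0 conv_x /=.
move/eqP; rewrite mulf_eq0 subr_eq0 => /orP[/eqP[] //|].
by rewrite -[p`_D]/(lead_coef p) lead_coef_eq0 (negPf p0).
Qed.

End Torsion.

Theorem corollary5p8 (R : comNzRingType)
    (gorR : gorenstein_local R) (krsR : krull_remak_schmidt R) :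
  (exists M : lmodType R,
      [/\ finitely_generated M, ~ zero_module M & periodic M]) <->
  (exists u : J R, u != 0 /\ torsion u).
Proof.
have [noethR locR injR] := gorR; split.
  move=> [M [fgM M0 perM]]; pose M' := FGMod fgM.
  have [n n0 e] := (periodic_class noethR locR krsR M').1 perM.
  exists (jcl (mclass M')); split.
    apply: (jcl_periodic_neq0 locR krsR n0 e).
    by apply/eqP => /mclass0P.
  exact: jcl_periodic_torsion n0 e.
move=> [u [u0 tu]]; have [m hm] := gorenstein_mcm noethR injR.
have [s [n [sa n0 e]]] := J_torsion_periodic locR krsR hm u0 tu.
exists (crep s); split; first exact: fgmodP.
  by move/crep0P/eqP; case: sa => /negP.
apply/(periodic_class noethR locR krsR); exists n => //.
by rewrite crepK.
Qed.
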